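(* Let $\mathcal G=(V,E,W)$ be a finite connected weighted graph, let $\eta\in\mathbb R_+^V$ (the case $\eta=0$ being ''no boundary condition''), and let $U\subset V$ be a non-empty subset that is indistinguishable from outside (for $\mathcal G$ and $\eta$). Let $\beta=(\beta_i)_{i\in V}$ be random with law $\nu^{W,\eta}$, let $H=H_\beta$ and $G=H^{-1}$. Put $V'=(V\setminus U)\cup\{u\}$, where $u$ is a new vertex, and define a symmetric matrix $G'$ indexed by $V'$ by $$G'(k,\ell)=\begin{cases} G(k,\ell) & k,\ell\notin U,\ k,\ell\neq u,\\ \frac{1}{|U|}\sum_{i\in U}G(k,i) & k\in V\setminus U,\ \ell=u,\\ \frac{1}{|U|^2}\sum_{i,j\in U}G(i,j) & k=\ell=u.\end{cases}$$ Let $\mathcal G'=(V',E',W')$ be the reduced weighted graph with weights $W'_{k,\ell}=W_{k,\ell}$ for $k,\ell\ne u$ and $W'_{k,u}=W'_{u,k}=\sum_{i\in U}W_{k,i}$ for $k\neq u$ (and $W'_{u,u}=0$), and let $\eta'\in\mathbb R_+^{V'}$ be given by $\eta'_u=\sum_{i\in U}\eta_i$ and $\eta'_k=\eta_k$ for $k\ne u$. Then $G'$ has the same law as the Green matrix of the $H^{2|2}$-model on $\mathcal G'$ with boundary condition $\eta'$, that is, the law of $(H'_{b})^{-1}$ where $b\sim\nu^{W',\eta'}$ and $H'_b$ is the matrix indexed by $V'$ with diagonal entries $2b_k$ and off-diagonal entries $-W'_{k,\ell}$. Furthermore, almost surely, the inverse of $G'$ is $H'_{\beta'}$, where $\beta'=(\beta'_k)_{k\in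 V'}$ is given by $\beta'_k=\beta_k$ for $k\in V'\setminus\{u\}$ and $$\frac{1}{2\beta'_u}=\frac{1}{|U|^2}\sum_{i,j\in U}\widehat G^{U}(i,j),\qquad \widehat G^U=(H_{U,U})^{-1},$$ $H_{U,U}$ being the submatrix of $H$ with rows and columns indexed by $U$.
   Context: A finite weighted graph $\mathcal G=(V,E,W)$ is a simple, unoriented, finite connected graph with edge weights $W_{ij}=W_{ji}>0$ for $\{i,j\}\in E$, and $W_{ij}=0$ if $\{i,j\}$ is not an edge; $W_{ii}=0$. For $\beta\in\mathbb R^V$, $H_\beta$ is the symmetric matrix indexed by $V$ with $H_\beta(i,i)=2\beta_i$ and $H_\beta(i,j)=-W_{ij}$ for $i\ne j$. For $\eta\in\mathbb R_+^V$ (non-negative entries), the law of the random potential of the $H^{2|2}$-model on $\mathcal G$ with boundary condition $\eta$ is the probability measure on $\mathbb R^V$ $$\nu^{W,\eta}(d\beta)=\Big(\sqrt{\tfrac{2}{\pi}}\Big)^{|V|}\mathbf 1_{\{H_\beta>0\}}\,e^{-\frac12\left(\langle 1,H_\beta 1\rangle+\langle\eta,H_\beta^{-1}\eta\rangle-2\langle 1,\eta\rangle\right)}\frac{1}{\sqrt{\det H_\beta}}\prod_{i\in V}d\beta_i,$$ where $H_\beta>0$ means positive definite, $1$ is the all-ones vector and $\langle x,y\rangle=\sum_{i\in V}x_iy_i$. The $H^{2|2}$-model without boundary condition is the case $\eta=0$. A subset $U\subset V$ is indistinguishable from outside if $W_{ki}=W_{kj}$ for all $i,j\in U$ and all $k\notin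 U$; when a boundary condition $\eta$ is given, one requires in addition $\eta_i=\eta_j$ for all $i,j\in U$. *)

(* Defs.v *)
From HB Require Import structures.
From mathcomp Require Import all_boot all_order all_algebra.
From mathcomp Require Import all_classical all_reals all_analysis.
Set Implicit Arguments.
Unset Strict Implicit.
Unset Printing Implicit Defensive.
Import Order.TTheory GRing.Theory Num.Theory.
Import numFieldNormedType.Exports.
Local Open Scope classical_set_scope.
Local Open Scope ring_scope.

(* 'M[T]_(m, n) carries the product sigma-algebra, generated by the entries. *)
Definition measure_matrix_display : measure_display -> measure_display.
Proof. exact. Qed.

Section measurable_matrix.
Context {d} {T : measurableType d}.
Variables m n : nat.

Definition entry_cylinders : set_system 'M[T]_(m, n) :=
  [set E | exists i j, exists2 Y : set T, measurable Y &
    E = [set M : 'M[T]_(m, n) | Y (M i j)]].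

Let mx_set0 : <<s entry_cylinders >> set0.
Proof. exact: sigma_algebra0. Qed.

Let mx_setC A : <<s entry_cylinders >> A -> <<s entry_cylinders >> (~` A).
Proof. exact: sigma_algebraC. Qed.

Let mx_bigcup (F : (set _)^nat) : (forall i, <<s entry_cylinders >> (F i)) ->
  <<s entry_cylinders >> (\bigcup_i (F i)).
Proof. exact: sigma_algebra_bigcup. Qed.

HB.instance Definition _ := @isMeasurable.Build (measure_matrix_display d)
  'M[T]_(m, n) <<s entry_cylinders >> mx_set0 mx_setC mx_bigcup.

Lemma measurable_entry i j :
  measurable_fun setT (fun M : 'M[T]_(m, n) => M i j).
Proof.
move=> _ Y mY; rewrite setTI; apply: sub_sigma_algebra.
by exists i, j, Y.
Qed.

Lemma measurable_fun_mxP d1 (T1 : measurableType d1) (f : T1 -> 'M[T]_(m, n)) :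
  measurable_fun setT f <->
  forall i j, measurable_fun setT (fun x => f x i j).
Proof.
split=> [mf i j|mf].
  exact: (measurableT_comp (measurable_entry i j) mf).
move=> _; apply: (@measurability _ _ _ _ _ _ entry_cylinders) => //.
by move=> _ [_ [i [j [Y mY ->]]] <-]; exact: mf.
Qed.

End measurable_matrix.

Section lebesgue_step.
Context {R : realType} (n : nat).
Variable mu : {sigma_finite_measure set 'cV[R]_n -> \bar R}.

Definition cons_col (p : measurableTypeR R * 'cV[R]_n) : 'cV[R]_n.+1 :=
  col_mx (p.1%:M : 'cV[R]_1) p.2.

Lemma measurable_cons_col : measurable_fun setT cons_col.
Proof.
apply/measurable_fun_mxP => i j.
have -> : (fun p => cons_col p i j) =
    (fun p => match fintype.split (i : 'I_(1 + n)) with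
              | inl _ => p.1 | inr k => p.2 k j end).
  apply/funext => p; rewrite /cons_col mxE; case: fintype.split => // a.
  by rewrite mxE !ord1 eqxx.
case: fintype.split => a; first exact: measurable_fst.
exact: (measurableT_comp (measurable_entry a j)).
Qed.

Definition lebesgue_step : set 'cV[R]_n.+1 -> \bar R :=
  pushforward (lebesgue_measure \x mu)%E cons_col.

Let step0 : lebesgue_step set0 = 0%E.
Proof. by rewrite /lebesgue_step /pushforward preimage_set0 measure0. Qed.

Let step_ge0 A : (0 <= lebesgue_step A)%E.
Proof. by rewrite /lebesgue_step /pushforward. Qed.

Let step_sigma_additive : semi_sigma_additive lebesgue_step.
Proof.
move=> F mF tF mUF; rewrite /lebesgue_step /pushforward preimage_bigcup.
have mcons A : measurable A -> measurable (cons_col @^-1` A).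
  by move=> mA; rewrite -[X in measurable X]setTI; exact: measurable_cons_col.
apply: measure_semi_sigma_additive.
- by move=> k; apply: mcons; exact: mF.
- apply/trivIsetP => /= i j _ _ ij; rewrite -preimage_setI.
  by move/trivIsetP : tF => /(_ _ _ _ _ ij) ->//; rewrite preimage_set0.
- by rewrite -preimage_bigcup; apply: mcons; exact: mUF.
Qed.

HB.instance Definition _ := isMeasure.Build _ _ _ lebesgue_step
  step0 step_ge0 step_sigma_additive.

Definition uncons_col (v : 'cV[R]_n.+1) : measurableTypeR R * 'cV[R]_n :=
  (v ord0 ord0, dsubmx (v : 'cV[R]_(1 + n))).

Lemma cons_col0 p : cons_col p ord0 ord0 = p.1.
Proof.
transitivity (cons_col p (lshift n ord0 : 'I_(1 + n)) ord0).
  by congr (cons_col _ _ _); exact/val_inj.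
by apply: etrans (col_mxEu _ _ _ _) _; rewrite mxE eqxx.
Qed.

Lemma cons_colS p i : cons_col p (lift ord0 i) ord0 = p.2 i ord0.
Proof.
transitivity (cons_col p (rshift 1 i : 'I_(1 + n)) ord0).
  by congr (cons_col _ _ _); exact/val_inj.
exact: col_mxEd.
Qed.

Lemma cons_colK : cancel cons_col uncons_col.
Proof. by move=> [x v]; rewrite /uncons_col cons_col0 /cons_col col_mxKd. Qed.

Lemma measurable_uncons_col : measurable_fun setT uncons_col.
Proof.
apply: measurable_fun_pair; first exact: measurable_entry.
apply/measurable_fun_mxP => i j.
have -> : (fun v => (uncons_col v).2 i j) = fun v => v (rshift 1 i) j.
  by apply/funext => v; rewrite mxE.
exact: measurable_entry.
Qed.

Let step_sigma_finite : sigma_finite setT lebesgue_step.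
Proof.
have /sigma_finiteP[F [FT ndF Foo]] := sigma_finiteT (@lebesgue_measure R).
have /sigma_finiteP[G [GT ndG Goo]] := sigma_finiteT mu.
exists (fun k => uncons_col @^-1` (F k `*` G k)).
  apply/seteqP; split => // v _.
  have [k _ Fk] : (\bigcup_k F k) (uncons_col v).1 by rewrite -FT.
  have [l _ Gl] : (\bigcup_l G l) (uncons_col v).2 by rewrite -GT.
  exists (maxn k l) => //; split.
  - by move: Fk; exact/subsetPset/ndF/leq_maxl.
  - by move: Gl; exact/subsetPset/ndG/leq_maxr.
move=> k; have [mF Fk] := Foo k; have [mG Gk] := Goo k; split.
  rewrite -[X in measurable X]setTI.
  by apply: measurable_uncons_col => //; exact: measurableX.
rewrite /lebesgue_step /pushforward -comp_preimage.
rewrite (_ : uncons_col \o cons_col = id); last exact/funext/cons_colK.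
by rewrite preimage_id product_measure1E// lte_mul_pinfty// ge0_fin_numE.
Qed.

HB.instance Definition _ := Measure_isSigmaFinite.Build _ _ _ lebesgue_step
  step_sigma_finite.

End lebesgue_step.

(* Lebesgue measure on R^n: the iterated product of the Lebesgue measure on R,
   transported to column vectors. *)
Fixpoint lebesgue_cV {R : realType} (n : nat) :
    {sigma_finite_measure set 'cV[R]_n -> \bar R} :=
  if n is m.+1 then lebesgue_step (lebesgue_cV m)
  else \d_(0 : 'cV[R]_0).

Lemma lebesgue_cV_box (R : realType) (n : nat) (A : 'I_n -> set R) :
  (forall i, measurable (A i)) ->
  lebesgue_cV n [set v : 'cV[R]_n | forall i, A i (v i ord0)] =
    (\prod_(i < n) lebesgue_measure (A i : set (measurableTypeR R)))%E.
Proof.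
elim: n A => [|n IHn] A mA.
  by rewrite big_ord0 /= diracE mem_set//; case.
rewrite big_ord_recl -IHn//= /lebesgue_step /pushforward.
set B := [set v : 'cV[R]_n | _].
have mB : measurable B.
  rewrite (_ : B = \bigcap_(i in [set: 'I_n])
      (fun v : 'cV[R]_n => v i ord0) @^-1` A (lift ord0 i)); last first.
    apply/seteqP; split => [v Bv i _|v Bv i]; first exact: Bv.
    exact: (Bv i Logic.I).
  apply: fin_bigcap_measurable => // i _; rewrite -[X in measurable X]setTI.
  exact: measurable_entry.
suff -> : @cons_col R n @^-1` [set v | forall i, A i (v i ord0)] = A ord0 `*` B.
  by rewrite product_measure1E//; exact: mA.
apply/seteqP; split=> -[x v] /=.
  by move=> H; split=> [|i]; [have := H ord0|have := H (lift ord0 i)];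
    rewrite (cons_col0, cons_colS).
move=> [/= Ax Bv] i.
by case: (unliftP ord0 i) => [j|] ->; rewrite (cons_col0, cons_colS) //; exact: Bv.
Qed.

Section model.
Context {R : realType}.

Section graph.
Variable V : finType.
Implicit Types (W : V -> V -> R) (eta : V -> R).

(* The edges are the pairs of positive weight. *)
Definition weighted_graph W : Prop :=
  [/\ forall i j, W i j = W j i, forall i, W i i = 0,
      forall i j, 0 <= W i j &
      forall i j, connect (fun x y => 0 < W x y) i j].

(* Matrices and vectors over V are indexed by 'I_#|V| through
   enum_val / enum_rank. *)
Definition Hmx W (b : 'cV[R]_#|V|) : 'M[R]_#|V| :=
  \matrix_(i, j) if i == j then 2 * b i ord0
                 else - W (enum_val i) (enum_val j).

Definition green W (b : 'cV[R]_#|V|) : 'M[R]_#|V| := invmx (Hmx W b).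

Definition posdefmx n (A : 'M[R]_n) : Prop :=
  A^T = A /\ forall x : 'cV[R]_n, x != 0 -> 0 < (x^T *m A *m x) ord0 ord0.

Definition dotcV n (x y : 'cV[R]_n) : R := \sum_i x i ord0 * y i ord0.

(* Outside {H_b > 0}, where invmx and sqrt may take default values, the
   indicator vanishes. *)
Definition nu_density W eta (b : 'cV[R]_#|V|) : R :=
  let H := Hmx W b in
  let one : 'cV[R]_#|V| := const_mx 1 in
  let h : 'cV[R]_#|V| := \col_i eta (enum_val i) in
  Num.sqrt (2 / pi) ^+ #|V| * \1_[set b' | posdefmx (Hmx W b')] b *
  expR (- 2^-1 * (dotcV one (H *m one) + dotcV h (invmx H *m h)
                  - 2 * dotcV one h)) *
  (Num.sqrt (\det H))^-1.

Definition nu W eta (A : set 'cV[R]_#|V|) : \bar R :=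
  (\int[lebesgue_cV #|V|]_(b in A) (nu_density W eta b)%:E)%E.

Definition indistinguishable W eta (U : {set V}) : Prop :=
  (forall i j k, i \in U -> j \in U -> k \notin U -> W k i = W k j) /\
  (forall i j, i \in U -> j \in U -> eta i = eta j).

End graph.

Section reduction.
Variables (V : finType) (U : {set V}).
Implicit Types (W : V -> V -> R) (eta : V -> R).

(* None is the new vertex u. *)
Definition redV : finType := option {k : V | k \notin U}.

Definition redW W (k l : redV) : R :=
  match k, l with
  | Some x, Some y => W (val x) (val y)
  | Some x, None | None, Some x => \sum_(i in U) W (val x) i
  | None, None => 0
  end.

Definition redeta eta (k : redV) : R :=
  if k is Some x then eta (val x) else \sum_(i in U) eta i.

Definition redG (G : 'M[R]_#|V|) : 'M[R]_#|redV| :=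
  let g i j := G (enum_rank i) (enum_rank j) in
  \matrix_(k, l)
    match (enum_val k : redV), (enum_val l : redV) with
    | Some x, Some y => g (val x) (val y)
    | Some x, None | None, Some x => #|U|%:R^-1 * \sum_(i in U) g (val x) i
    | None, None => (#|U|%:R ^+ 2)^-1 * \sum_(i in U) \sum_(j in U) g i j
    end.

Definition submxU (H : 'M[R]_#|V|) : 'M[R]_#|U| :=
  \matrix_(i, j) H (enum_rank (enum_val i)) (enum_rank (enum_val j)).

(* The value at u solves 1 / (2 beta'_u) = |U|^-2 sum_(i, j in U) G^U(i, j). *)
Definition redbeta W (b : 'cV[R]_#|V|) : 'cV[R]_#|redV| :=
  \col_k
    if (enum_val k : redV) is Some x then b (enum_rank (val x)) ord0
    else (2 * ((#|U|%:R ^+ 2)^-1 *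
               \sum_i \sum_j invmx (submxU (Hmx W b)) i j))^-1.

Lemma redW_weighted_graph W : U != finset.set0 ->
  weighted_graph W -> weighted_graph (@redW W).
Proof.
move=> /set0Pn[u0 u0U] [Wsym W0 Wge0 Wconn]; split.
- by move=> [x|] [y|] //=.
- by move=> [x|] //=.
- by move=> [x|] [y|] //=; apply: sumr_ge0.
pose e (k l : redV) := 0 < redW W k l.
pose q (x : V) : redV := insub x.
have qU x : x \in U -> q x = None by move=> xU; rewrite /q insubF// xU.
have qNU (x : {k : V | k \notin U}) : q (val x) = Some x by rewrite /q valK.
have qS x : x \notin U -> exists2 a, q x = Some a & val a = x.
  by move=> xU; exists (Sub x xU); rewrite ?SubK // /q insubT.
have qe x y : 0 < W x y -> connect e (q x) (q y).
  move=> Wxy; have [xU|/qS[a -> ax]] := boolP (x \in U);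
    have [yU|/qS[b -> yb]] := boolP (y \in U); rewrite ?qU //;
    apply: connect1; rewrite /e /= ?ax ?yb //.
  - by rewrite (bigD1 x)//= Wsym ltr_pwDl// sumr_ge0.
  - by rewrite (bigD1 y)//= ltr_pwDl// sumr_ge0.
have qc x y : connect e (q x) (q y).
  have /connectP[p + ->] := Wconn x y.
  elim: p x => [|z p IHp] x //= /andP[Wxz pz].
  exact: connect_trans (qe _ _ Wxz) (IHp _ pz).
have qs k : exists x, k = q x.
  by case: k => [x|]; [exists (val x); rewrite qNU|exists u0; rewrite qU].
by move=> k l; have [x ->] := qs k; have [y ->] := qs l; exact: qc.
Qed.

End reduction.
End model.

Arguments redW {R V} U W k l.
Arguments redeta {R V} U eta k.
Arguments redG {R V} U G.
Arguments redbeta {R V} U W b.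

(* Main.v *)
From HB Require Import structures.
Require Import Defs.
From mathcomp Require Import all_boot all_order all_algebra.
From mathcomp Require Import all_classical all_reals all_analysis.
From mathcomp Require Import perm measurable_realfun ring lra.
Set Implicit Arguments.
Unset Strict Implicit.
Unset Printing Implicit Defensive.
Import Order.TTheory GRing.Theory Num.Theory.
Import numFieldNormedType.Exports.
Local Open Scope classical_set_scope.
Local Open Scope ring_scope.

(** The potential seen through a Schur complement.

    Split the vertices into U and its complement C. Block elimination of H_UU
    turns the density of nu into the product of the marginal density of beta_U and
    the conditional density of beta_C given beta_U, both of the same family
    (dens_block). The conditional density involves beta_U only through
    W_CU H_UU^-1 W_UC and W_CU H_UU^-1 eta_U. When U is indistinguishable, W_UC is the
    rank-one matrix 1 w0 and eta_U a constant e, so that both depend on beta_U only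
    through the scalar s = <1, H_UU^-1 1>, the sum of all the entries of the Green
    matrix of U (dens_block_rank1). The reduced graph has the same structure with a
    single vertex u in place of U, weights |U| w0 and boundary condition |U| e, and
    the conditional density is the same function of s' = |U|^2 / (2 beta'_u).

    It remains to see that s and s' have the same law (mass_reduction). Integrating
    the vertices out one at a time shows that every density of the family has
    total mass one (integral_dens); the one-vertex case is the integral of
    x^(-1/2) exp (- x - a^2 / x), for which an antiderivative is explicit in terms of
    the Gaussian distribution function. Since the boundary condition k 1 enters the
    density through exp (- k^2 s / 2 + k |U|), this evaluates the Laplace transform
    of s under the boundary condition h 1: it is
    exp (- |U| (sqrt (h^2 + 2 l) - h)), the same as that of s'. A finite measure on
    the positive half-line is determined by its Laplace transform (laplace_unique),
    which gives equality in law of beta' and of the reduced potential (nu_redbeta).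

    Finally, wherever H is positive definite the averaged Green matrix is the
    inverse of H'_beta', by comparing the block formulas for the two inverses
    (averaged_green, redG_green). This is the almost sure statement, and it
    transports the law of beta' to that of the Green matrix. *)

(** * Schur complements and positive definite matrices *)

Section schur.
Context {R : realType}.

Lemma dotcVE n (x y : 'cV[R]_n) : dotcV x y = (x^T *m y) ord0 ord0.
Proof. by rewrite mxE; apply: eq_bigr => i _; rewrite mxE. Qed.

Lemma invmx_uniq n (A B : 'M[R]_n) : A *m B = 1%:M -> invmx A = B.
Proof.
move=> AB; have [uA _] := mulmx1_unit AB.
by rewrite -[RHS](mulKmx uA) AB mulmx1.
Qed.

Lemma posdefmx_unit n (A : 'M[R]_n) : posdefmx A -> A \in unitmx.
Proof.
move=> [_ Apos]; rewrite unitmxE unitfE; apply/negP => /det0P[v v0 vA].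
have : v^T != 0 by apply: contra v0 => /eqP v0; rewrite -[v]trmxK v0 trmx0.
by move=> /Apos; rewrite trmxK vA mul0mx mxE ltxx.
Qed.

Lemma invmx_sym n (A : 'M[R]_n) : A^T = A -> (invmx A)^T = invmx A.
Proof. by move=> sA; rewrite trmx_inv sA. Qed.

Lemma posdefmx_cong n (L A : 'M[R]_n) : L \in unitmx ->
  posdefmx A -> posdefmx (L *m A *m L^T).
Proof.
move=> uL [sA pA]; split; first by rewrite !trmx_mul trmxK sA mulmxA.
move=> x x0; have /pA : L^T *m x != 0.
  apply: contra x0 => /eqP Lx.
  by rewrite -[x](@mulKmx _ _ _ L^T) ?unitmx_tr// Lx mulmx0.
by rewrite trmx_mul trmxK !mulmxA.
Qed.

Lemma posdefmx_congE n (L A : 'M[R]_n) : L \in unitmx ->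
  posdefmx (L *m A *m L^T) <-> posdefmx A.
Proof.
move=> uL; split; last exact: posdefmx_cong.
move/(@posdefmx_cong _ (invmx L)); rewrite unitmx_inv => /(_ uL).
rewrite trmx_inv !mulmxA mulVmx// mul1mx -mulmxA mulmxV ?mulmx1//.
by rewrite unitmx_tr.
Qed.

Section blocks.
Variables (m p : nat) (A : 'M[R]_m) (B : 'M[R]_(m, p)) (D : 'M[R]_p).

Definition schur_compl : 'M[R]_p := D - B^T *m invmx A *m B.

Let M := block_mx A B B^T D.
Let L := block_mx 1%:M 0 (B^T *m invmx A) 1%:M : 'M[R]_(m + p).

Let uL : L \in unitmx.
Proof. by rewrite unitmxE det_lblock !det1 mulr1 unitr1. Qed.

(** One step of block Gaussian elimination: a congruence by a unit triangular
    matrix reduces positivity and the determinant of M to those of A and of its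
    Schur complement. *)
Lemma schur_factorization : A^T = A -> A \in unitmx ->
  M = L *m block_mx A 0 0 schur_compl *m L^T.
Proof.
move=> sA uA; rewrite /L tr_block_mx !mulmx_block !trmx1 trmx0.
rewrite !(mul1mx, mulmx1, mul0mx, mulmx0, addr0, add0r).
rewrite trmx_mul trmxK invmx_sym// mulKVmx// mulmxKV//.
by rewrite /M /schur_compl !mulmxA addrC subrK.
Qed.

Lemma posdefmx_diag (S : 'M[R]_p) :
  posdefmx (block_mx A 0 0 S) <-> posdefmx A /\ posdefmx S.
Proof.
have qE (x : 'cV[R]_m) (y : 'cV[R]_p) :
  ((col_mx x y)^T *m block_mx A 0 0 S *m col_mx x y) ord0 ord0 =
    (x^T *m A *m x) ord0 ord0 + (y^T *m S *m y) ord0 ord0.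
  rewrite tr_col_mx mul_row_block !mulmx0 addr0 add0r.
  by rewrite mul_row_col mxE.
split=> [[sM pM]|[[sA pA] [sS pS]]].
  move: sM; rewrite tr_block_mx !trmx0 => /eq_block_mx[sA _ _ sS].
  split; split=> // x x0.
  - have := pM (col_mx x 0); rewrite col_mx_eq0 (negbTE x0) => /(_ erefl).
    by rewrite qE mulmx0 [X in _ + X]mxE addr0.
  - have := pM (col_mx (0 : 'cV[R]_m) x); rewrite col_mx_eq0 (negbTE x0) andbF => /(_ erefl).
    by rewrite qE mulmx0 [X in X + _]mxE add0r.
split; first by rewrite tr_block_mx !trmx0 sA sS.
move=> x; rewrite -[x]vsubmxK col_mx_eq0 negb_and qE.
have ge0 n (C : 'M[R]_n) : (forall x : 'cV[R]_n, x != 0 ->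
    0 < (x^T *m C *m x) ord0 ord0) ->
    forall x : 'cV[R]_n, 0 <= (x^T *m C *m x) ord0 ord0.
  move=> pC z; have [->|/pC/ltW//] := eqVneq z 0.
  by rewrite mulmx0 mxE.
by case/orP => [/pA|/pS] pos; [apply: ltr_pwDl|apply: ltr_wpDl] => //;
  apply: ge0.
Qed.

Lemma posdefmx_block :
  posdefmx M <-> posdefmx A /\ posdefmx schur_compl.
Proof.
have pA : posdefmx M -> posdefmx A.
  move=> [sM pM]; split.
    by move: sM; rewrite /M tr_block_mx => /eq_block_mx[].
  move=> x x0; have := pM (col_mx x 0).
  rewrite col_mx_eq0 (negbTE x0) => /(_ erefl).
  rewrite tr_col_mx mul_row_block trmx0 !mul0mx !addr0.
  by rewrite mul_row_col mulmx0 addr0.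
split=> [pM|[pA' pS]].
  have [sA uA] : A^T = A /\ A \in unitmx.
    by have /pA := pM; split; [case: (pA pM)|exact/posdefmx_unit/pA].
  by move: pM; rewrite schur_factorization// posdefmx_congE// posdefmx_diag.
rewrite schur_factorization ?posdefmx_unit//; last by case: pA'.
by rewrite posdefmx_congE// posdefmx_diag.
Qed.

Lemma det_schur : A^T = A -> A \in unitmx ->
  \det M = \det A * \det schur_compl.
Proof.
move=> sA uA; rewrite schur_factorization// !det_mulmx det_tr.
by rewrite det_lblock !det1 !mul1r mulr1 det_ublock.
Qed.

Lemma invmx_schur : A^T = A -> A \in unitmx -> schur_compl \in unitmx ->
  let Ai := invmx A in let Si := invmx schur_compl in
  invmx M = block_mx (Ai + Ai *m B *m Si *m B^T *m Ai) (- (Ai *m B *m Si))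
                     (- (Si *m B^T *m Ai)) Si.
Proof.
move=> sA uA uS Ai Si; apply: invmx_uniq; rewrite mulmx_block.
have DE : D = schur_compl + B^T *m Ai *m B by rewrite subrK.
rewrite scalar_mx_block; congr block_mx.
- by rewrite mulmxDr mulmxN !mulmxA mulmxV// !mul1mx addrK.
- by rewrite mulmxN !mulmxA mulmxV// !mul1mx addNr.
- rewrite mulmxDr mulmxN DE mulmxDl !mulmxA mulmxV// !mul1mx.
  by rewrite opprD addrACA subrr subrr addr0.
- by rewrite mulmxN DE mulmxDl !mulmxA mulmxV// addrCA addNr addr0.
Qed.

End blocks.

Lemma posdefmx_scalar (a : R) : posdefmx (a%:M : 'M[R]_1) <-> 0 < a.
Proof.
split=> [[_ /(_ 1%:M)]|a0].
  rewrite trmx1 mul1mx mulmx1 mxE eqxx; apply.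
  by apply/eqP => /matrixP/(_ ord0 ord0)/eqP; rewrite !mxE oner_eq0.
split=> [|x x0]; first by rewrite tr_scalar_mx.
have -> : x = (x ord0 ord0)%:M by apply/matrixP => i j; rewrite !ord1 mxE eqxx.
have {}x0 : x ord0 ord0 != 0.
  by apply: contra x0 => /eqP x0; apply/eqP/matrixP => i j; rewrite !ord1 x0 mxE.
rewrite tr_scalar_mx -!scalar_mxM mxE eqxx mulrAC -expr2 mulr_gt0//.
by rewrite exprn_even_gt0.
Qed.

Lemma posdefmx_det_gt0 n (A : 'M[R]_n) : posdefmx A -> 0 < \det A.
Proof.
elim: n A => [|n IHn] A pA; first by rewrite det_mx00.
have [sA _] := pA; have {sA} : (A : 'M[R]_(1 + n))^T = A by [].
move: pA; rewrite -[A](@submxK _ 1 n 1 n).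
set a := ulsubmx _; set B := ursubmx _; set B' := dlsubmx _; set D := drsubmx _.
rewrite tr_block_mx => + /eq_block_mx[_ _ BB' _]; rewrite -BB'.
have aE : a = (a ord0 ord0)%:M.
  by apply/matrixP => i j; rewrite !ord1 [RHS]mxE eqxx.
move=> /((posdefmx_block a B D).1)[pa pS].
have [sa _] := pa; have ua := posdefmx_unit pa.
rewrite [ltRHS](det_schur B D sa ua).
rewrite mulr_gt0//; last exact: IHn.
by move: pa; rewrite aE posdefmx_scalar det_scalar1.
Qed.

Section density.

(** The model over 'I_n with arbitrary weights: the vertices integrated out one
    by one leave Schur complements, whose diagonal is no longer zero, so Hm
    never reads the diagonal of W. *)
Definition Hm n (W : 'M[R]_n) (b : 'cV[R]_n) : 'M[R]_n :=
  \matrix_(i, j) if i == j then 2 * b i ord0 else - W i j.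

(** The density of nu for matrix data; see nu_densityE. *)
Definition dens n (W : 'M[R]_n) (eta : 'cV[R]_n) (b : 'cV[R]_n) : R :=
  let one : 'cV[R]_n := const_mx 1 in
  Num.sqrt (2 / pi) ^+ n * \1_[set b' | posdefmx (Hm W b')] b *
  expR (- 2^-1 * (dotcV one (Hm W b *m one) + dotcV eta (invmx (Hm W b) *m eta)
                  - 2 * dotcV one eta)) *
  (Num.sqrt (\det (Hm W b)))^-1.

Lemma nu_densityE (V : finType) (W : V -> V -> R) (eta : V -> R) b :
  nu_density W eta b =
  dens (\matrix_(i, j) W (enum_val i) (enum_val j)) (\col_i eta (enum_val i)) b.
Proof.
rewrite /nu_density /dens; have HE b' : Hmx W b' =
    Hm (\matrix_(i, j) W (enum_val i) (enum_val j)) b'.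
  by apply/matrixP => i j; rewrite !mxE.
by under eq_fun do rewrite HE; rewrite HE.
Qed.

Lemma dens_ge0 n W eta b : 0 <= @dens n W eta b.
Proof.
by rewrite /dens !mulr_ge0// ?exprn_ge0 ?sqrtr_ge0 ?expR_ge0 ?invr_ge0 ?sqrtr_ge0.
Qed.

Lemma dens0 n W eta b : ~ posdefmx (Hm W b) -> @dens n W eta b = 0.
Proof. by move=> npd; rewrite /dens indicE memNset// mulr0 !mul0r. Qed.

Lemma Hm_sym n (W : 'M[R]_n) b : W^T = W -> (Hm W b)^T = Hm W b.
Proof.
move=> sW; apply/matrixP => i j; rewrite !mxE eq_sym.
by case: eqP => [->//|_]; rewrite -{1}sW mxE.
Qed.

Lemma Hm_block m p (A : 'M[R]_m) (w : 'M[R]_(m, p)) (D : 'M[R]_p) u v :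
  Hm (block_mx A w w^T D) (col_mx u v) =
    block_mx (Hm A u) (- w) (- w)^T (Hm D v).
Proof.
apply/matrixP => i j.
case: (split_ordP i) => k ->; case: (split_ordP j) => l ->; rewrite [LHS]mxE
  ?(block_mxEul, block_mxEur, block_mxEdl, block_mxEdr, col_mxEu, col_mxEd,
    eq_lshift, eq_rshift, eq_lrshift, eq_rlshift) ?mxE //.
Qed.

End density.
End schur.

(** * Conditioning on a block of vertices *)

Section factor.
Context {R : realType}.

Lemma dotcVC n (x y : 'cV[R]_n) : dotcV x y = dotcV y x.
Proof. by apply: eq_bigr => i _; rewrite mulrC. Qed.

Lemma dotcVDr n (x y z : 'cV[R]_n) : dotcV x (y + z) = dotcV x y + dotcV x z.
Proof. by rewrite -big_split; apply: eq_bigr => i _; rewrite mxE mulrDr. Qed.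

Lemma dotcVDl n (x y z : 'cV[R]_n) : dotcV (x + y) z = dotcV x z + dotcV y z.
Proof. by rewrite dotcVC dotcVDr !(dotcVC z). Qed.

Lemma dotcVZr n (a : R) (x y : 'cV[R]_n) : dotcV x (a *: y) = a * dotcV x y.
Proof. by rewrite mulr_sumr; apply: eq_bigr => i _; rewrite mxE mulrCA. Qed.

Lemma dotcVZl n (a : R) (x y : 'cV[R]_n) : dotcV (a *: x) y = a * dotcV x y.
Proof. by rewrite dotcVC dotcVZr dotcVC. Qed.

Lemma dotcVNr n (x y : 'cV[R]_n) : dotcV x (- y) = - dotcV x y.
Proof. by rewrite -scaleN1r dotcVZr mulN1r. Qed.

Lemma dotcV_adj m n (M : 'M[R]_(m, n)) x y :
  dotcV x (M *m y) = dotcV (M^T *m x) y.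
Proof. by rewrite !dotcVE trmx_mul trmxK mulmxA. Qed.

Lemma dotcV_col_mx m n (x x' : 'cV[R]_m) (y y' : 'cV[R]_n) :
  dotcV (col_mx x y) (col_mx x' y') = dotcV x x' + dotcV y y'.
Proof.
rewrite /dotcV big_split_ord; congr (_ + _); apply: eq_bigr => i _.
  by rewrite !col_mxEu.
by rewrite !col_mxEd.
Qed.

Lemma densE n (W : 'M[R]_n) eta b : posdefmx (Hm W b) ->
  dens W eta b = Num.sqrt (2 / pi) ^+ n *
  expR (- 2^-1 * (dotcV (const_mx 1) (Hm W b *m const_mx 1) +
    dotcV eta (invmx (Hm W b) *m eta) - 2 * dotcV (const_mx 1) eta)) *
  (Num.sqrt (\det (Hm W b)))^-1.
Proof. by move=> pH; rewrite /dens indicE mem_set// mulr1. Qed.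

(** Conditioning in the model. Eliminating the first block A, the determinant and
    the three quadratic terms of the exponent split: the marginal of u is again a
    density of the same family, on A, with boundary condition increased by the
    weights towards the other block, and given u the vector v has a density of the
    same family for the Schur complement, up to a translation which accounts for
    the diagonal of K. The cross terms cancel because the linear term
    - 2 <1, eta> of the exponent absorbs them. *)
Lemma dens_block m p (A : 'M[R]_m) (w : 'M[R]_(m, p)) (D : 'M[R]_p)
    (eu : 'cV[R]_m) (ed : 'cV[R]_p) (u : 'cV[R]_m) (v : 'cV[R]_p) :
  A^T = A ->
  let G := invmx (Hm A u) in let K := w^T *m G *m w in
  dens (block_mx A w w^T D) (col_mx eu ed) (col_mx u v) =
  dens A (eu + w *m const_mx 1) u *
  dens (D + K) (ed + w^T *m G *m eu) (v - \col_i (2^-1 * K i i)).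
Proof.
move=> sA G K; set u1 : 'cV[R]_m := const_mx 1.
set v1 : 'cV[R]_p := const_mx 1.
have SE : Hm (D + K) (v - \col_i (2^-1 * K i i)) =
    schur_compl (Hm A u) (- w) (Hm D v).
  rewrite /schur_compl mulmxN [(- w)^T]linearN !mulNmx opprK -/K; clearbody K.
  apply/matrixP => i j; rewrite !mxE.
  have [<-|_] := eqVneq i j; last by rewrite opprD.
  by rewrite mulrBr mulrA mulfV// mul1r.
have HE := Hm_block A w D u v.
have [pA|nA] := pselect (posdefmx (Hm A u)); last first.
  by rewrite !(dens0 _ nA) mul0r dens0// HE posdefmx_block => -[].
have [pS|nS] := pselect (posdefmx (schur_compl (Hm A u) (- w) (Hm D v)));
    last first.
  rewrite dens0; last by rewrite HE posdefmx_block => -[].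
  by rewrite [X in _ * X]dens0 ?mulr0// SE.
have [uA uS] := (posdefmx_unit pA, posdefmx_unit pS).
have sH : (Hm A u)^T = Hm A u by case: pA.
have sG : G^T = G by rewrite invmx_sym.
have pM : posdefmx (block_mx (Hm A u) (- w) (- w)^T (Hm D v)).
  exact/posdefmx_block.
rewrite !densE ?HE ?SE// det_schur// (sqrtrM _ (ltW (posdefmx_det_gt0 pA))) invfM exprD.
set S := schur_compl _ _ _ in pS uS SE *.
set y := ed + w^T *m G *m eu.
have E1 : dotcV (const_mx 1)
      (block_mx (Hm A u) (- w) (- w)^T (Hm D v) *m const_mx 1) =
    dotcV u1 (Hm A u *m u1) - 2 * dotcV u1 (w *m v1) +
    (dotcV v1 (S *m v1) + dotcV (w *m v1) (G *m (w *m v1))).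
  have -> : Hm D v = S + w^T *m G *m w.
    by rewrite /S /schur_compl mulmxN [(- w)^T]linearN !mulNmx opprK subrK.
  rewrite -col_mx_const mul_block_col dotcV_col_mx [(- w)^T]linearN !mulNmx.
  rewrite mulmxDl !(dotcVDr, dotcVNr) -!mulmxA.
  by rewrite [dotcV v1 (w^T *m (G *m _))]dotcV_adj [dotcV v1 (w^T *m u1)]dotcV_adj
    trmxK [dotcV (w *m v1) u1]dotcVC -/u1 -/v1; ring.
have E2 : dotcV (col_mx eu ed)
      (invmx (block_mx (Hm A u) (- w) (- w)^T (Hm D v)) *m col_mx eu ed) =
    dotcV eu (G *m eu) + dotcV y (invmx S *m y).
  rewrite invmx_schur// -/G -/S mul_block_col dotcV_col_mx.
  rewrite [(- w)^T]linearN !(mulmxN, mulNmx, opprK) !mulmxDl -!mulmxA.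
  rewrite -addrA -mulmxDr -mulmxDr -mulmxDr -mulmxDr [w^T *m _ + _]addrC.
  have yE : ed + w^T *m (G *m eu) = y by rewrite mulmxA.
  rewrite yE mulmxDr dotcVDr.
  rewrite [dotcV eu (G *m (w *m _))]dotcV_adj sG [dotcV (G *m eu) (w *m _)]dotcV_adj.
  by rewrite -addrA -dotcVDl [_ + ed]addrC yE.
have E3 : dotcV (eu + w *m v1) (G *m (eu + w *m v1)) = dotcV eu (G *m eu) +
    dotcV (w *m v1) (G *m (w *m v1)) + 2 * dotcV v1 (w^T *m (G *m eu)).
  rewrite mulmxDr !(dotcVDr, dotcVDl) [dotcV eu (G *m (w *m v1))]dotcV_adj sG.
  rewrite [dotcV v1 (w^T *m _)]dotcV_adj trmxK [dotcV (G *m eu) _]dotcVC; ring.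
have E4 : dotcV v1 y = dotcV v1 ed + dotcV v1 (w^T *m (G *m eu)).
  by rewrite dotcVDr mulmxA.
rewrite E1 E2 E3 -col_mx_const dotcV_col_mx dotcVDr E4 -/u1 -/v1.
rewrite [RHS]mulrACA; congr (_ * _); rewrite [RHS]mulrACA; congr (_ * _).
by rewrite -expRD; congr expR; ring.
Qed.
End factor.

(** * Measurability of matrix functions *)

Section meas.
Context {d} {T : measurableType d} {R : realType}.
Implicit Types f g : T -> R.

(** Writing 1 / x as x (x^2)^(-1) reduces to real powers of nonnegative numbers,
    and is still correct at 0. *)
Lemma measurable_fun_inv f : measurable_fun setT f ->
  measurable_fun setT (fun x => (f x)^-1).
Proof.
move=> mf; have -> : (fun x => (f x)^-1) = (fun x => f x * (f x ^+ 2) `^ (-1)).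
  apply/funext => x; rewrite powR_inv1 ?sqr_ge0//.
  have [->|fx0] := eqVneq (f x) 0; first by rewrite invr0 mul0r.
  by rewrite expr2 invfM mulrA mulfV// mul1r.
apply: measurable_funM => //.
by apply: (measurableT_comp (measurable_powR _)); exact: measurable_funX.
Qed.

Lemma measurable_fun_sqrt f : measurable_fun setT f ->
  measurable_fun setT (fun x => Num.sqrt (f x)).
Proof.
move=> mf; apply: (measurableT_comp _ mf); apply: continuous_measurable_fun.
exact: sqrt_continuous.
Qed.

Lemma measurable_fun_det n (f : T -> 'M[R]_n) : measurable_fun setT f ->
  measurable_fun setT (fun x => \det (f x)).
Proof.
move=> /measurable_fun_mxP mf; apply: measurable_sum => s.
apply: measurable_funM => //; apply: measurable_prod => i _.
exact: mf.
Qed.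

Lemma measurable_fun_mulmx m n p (f : T -> 'M[R]_(m, n)) (g : T -> 'M[R]_(n, p)) :
  measurable_fun setT f -> measurable_fun setT g ->
  measurable_fun setT (fun x => f x *m g x).
Proof.
move=> /measurable_fun_mxP mf /measurable_fun_mxP mg.
apply/measurable_fun_mxP => i j.
under eq_fun do rewrite mxE.
by apply: measurable_sum => k; exact: measurable_funM.
Qed.

Lemma measurable_fun_trmx m n (f : T -> 'M[R]_(m, n)) :
  measurable_fun setT f -> measurable_fun setT (fun x => (f x)^T).
Proof.
move=> /measurable_fun_mxP mf; apply/measurable_fun_mxP => i j.
under eq_fun do rewrite mxE.
exact: mf.
Qed.

Lemma measurable_fun_addmx m n (f g : T -> 'M[R]_(m, n)) :
  measurable_fun setT f -> measurable_fun setT g ->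
  measurable_fun setT (fun x => f x + g x).
Proof.
move=> /measurable_fun_mxP mf /measurable_fun_mxP mg.
apply/measurable_fun_mxP => i j.
under eq_fun do rewrite mxE.
exact: measurable_funD.
Qed.

Lemma measurable_fun_oppmx m n (f : T -> 'M[R]_(m, n)) :
  measurable_fun setT f -> measurable_fun setT (fun x => - f x).
Proof.
move=> /measurable_fun_mxP mf; apply/measurable_fun_mxP => i j.
under eq_fun do rewrite mxE.
exact: measurable_funN.
Qed.

Lemma measurable_fun_mxsub m n m' n' (r : 'I_m' -> 'I_m) (c : 'I_n' -> 'I_n)
    (f : T -> 'M[R]_(m, n)) :
  measurable_fun setT f -> measurable_fun setT (fun x => mxsub r c (f x)).
Proof.
move=> /measurable_fun_mxP mf; apply/measurable_fun_mxP => i j.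
under eq_fun do rewrite mxE.
exact: mf.
Qed.

Lemma measurable_fun_invmx n (f : T -> 'M[R]_n) : measurable_fun setT f ->
  measurable_fun setT (fun x => invmx (f x)).
Proof.
move=> mf; have mdet := measurable_fun_det mf.
apply/measurable_fun_mxP => i j.
have -> : (fun x => invmx (f x) i j) =
    (fun x => if \det (f x) == 0 then f x i j
              else (\det (f x))^-1 * ((-1) ^+ (j + i) *
                     \det (mxsub (lift j) (lift i) (f x)))).
  apply/funext => x; rewrite /invmx unitmxE unitfE; case: eqP => //= _.
  rewrite !mxE /cofactor; congr (_ * (_ * \det _)).
  by apply/matrixP => k l; rewrite !mxE.
move/measurable_fun_mxP : (mf) => mfij; apply: measurable_fun_ifT.
- exact: measurable_fun_eqr.
- exact: mfij.
- apply: measurable_funM; first exact: measurable_fun_inv.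
  by apply: measurable_funM => //; exact/measurable_fun_det/measurable_fun_mxsub.
Qed.

Lemma measurable_fun_dotcV n (f g : T -> 'cV[R]_n) :
  measurable_fun setT f -> measurable_fun setT g ->
  measurable_fun setT (fun x => dotcV (f x) (g x)).
Proof.
move=> /measurable_fun_mxP mf /measurable_fun_mxP mg.
by apply: measurable_sum => i; apply: measurable_funM.
Qed.

End meas.

Section posdef.
Context {R : realType}.

(** Positivity decided one pivot at a time, which exhibits the set of positive
    definite matrices as a measurable set by induction on the size. *)
Definition schur_step n (A : 'M[R]_(1 + n)) : 'M[R]_n :=
  schur_compl (ulsubmx A) (ursubmx A) (drsubmx A).

Lemma posdefmx_step n (A : 'M[R]_(1 + n)) :
  posdefmx A <-> A^T = A /\ (0 < A ord0 ord0 /\ posdefmx (schur_step A)).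
Proof.
have aE : ulsubmx A = (A ord0 ord0)%:M.
  apply/matrixP => i j; rewrite !ord1 !mxE eqxx /=.
  by congr (A _ _); apply/val_inj.
have : A^T = A -> A = block_mx (ulsubmx A) (ursubmx A) (ursubmx A)^T (drsubmx A).
  by move=> sA; rewrite trmx_ursub sA submxK.
move=> AE; rewrite -posdefmx_scalar -aE; split=> [pA|[sA pA]].
  by have [/[dup] sA /AE AE' _] := pA; split=> //; apply/posdefmx_block; rewrite -AE'.
by rewrite (AE sA); apply/posdefmx_block.
Qed.

Lemma measurable_posdefmx n : measurable [set A : 'M[R]_n | posdefmx A].
Proof.
elim: n => [|n IHn].
  rewrite (_ : [set _ | _] = setT)//; apply/seteqP; split => // A _.
  split; first by apply/matrixP => -[].
  by move=> x; rewrite [x]flatmx0 eqxx.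
have mid : measurable_fun setT (fun A : 'M[R]_(1 + n) => A) by exact: measurable_id.
have mE := (measurable_fun_mxP _).1 mid.
rewrite (_ : [set _ | _] =
    \bigcap_(ij in [set: 'I_(1 + n) * 'I_(1 + n)])
       (fun A : 'M[R]_(1 + n) => A ij.1 ij.2 - A ij.2 ij.1) @^-1` [set 0] `&`
    ((fun A : 'M[R]_(1 + n) => A ord0 ord0) @^-1` `]0, +oo[ `&`
     @schur_step n @^-1` [set A : 'M[R]_n | posdefmx A])); last first.
  apply/seteqP; split => [A /posdefmx_step[sA [A0 pS]]|A [sA [A0 pS]]].
    split; last by split=> //=; rewrite in_itv/= A0.
    by move=> [i j] _ /=; rewrite -[in X in X - _]sA mxE subrr.
  apply/posdefmx_step; split; last by split=> //; move: A0; rewrite /= in_itv/= andbT.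
  apply/matrixP => i j; rewrite mxE; apply/esym/eqP; rewrite -subr_eq0.
  by have := sA (i, j) I => /= ->.
apply: measurableI; last apply: measurableI.
- apply: fin_bigcap_measurable => // -[i j] _.
  rewrite -[X in measurable X]setTI; apply: measurable_funB => //.
- by rewrite -[X in measurable X]setTI; apply: mE => //; exact: measurable_itv.
- rewrite -[X in measurable X]setTI.
  suff : measurable_fun setT (@schur_step n) by apply.
  have msub m' n' (r : 'I_m' -> _) (c : 'I_n' -> _) :
      measurable_fun setT (fun A : 'M[R]_(1 + n) => mxsub r c A).
    exact: measurable_fun_mxsub.
  rewrite /schur_step /schur_compl.
  apply: measurable_fun_addmx; last apply: measurable_fun_oppmx.
    apply/measurable_fun_mxP => i j; under eq_fun do rewrite !mxE.
    exact: mE.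
  have mur : measurable_fun setT (fun A : 'M[R]_(1 + n) => ursubmx A).
    apply/measurable_fun_mxP => i j; under eq_fun do rewrite !mxE.
    exact: mE.
  apply: measurable_fun_mulmx => //; apply: measurable_fun_mulmx.
    exact: measurable_fun_trmx.
  apply: measurable_fun_invmx.
  apply/measurable_fun_mxP => i j; under eq_fun do rewrite !mxE.
    exact: mE.
Qed.

Lemma measurable_Hm d (T : measurableType d) n (W : T -> 'M[R]_n) (b : T -> 'cV[R]_n) :
  measurable_fun setT W -> measurable_fun setT b ->
  measurable_fun setT (fun x => Hm (W x) (b x)).
Proof.
move=> /measurable_fun_mxP mW /measurable_fun_mxP mb.
apply/measurable_fun_mxP => i j; under eq_fun do rewrite mxE.
case: eqP => _; last exact: measurable_funN.
exact: measurable_funM.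
Qed.

Lemma measurable_dens d (T : measurableType d) n (W : T -> 'M[R]_n)
    (eta b : T -> 'cV[R]_n) :
  measurable_fun setT W -> measurable_fun setT eta -> measurable_fun setT b ->
  measurable_fun setT (fun x => dens (W x) (eta x) (b x)).
Proof.
move=> mW meta mb; have mH := measurable_Hm mW mb.
rewrite /dens; apply: measurable_funM; first apply: measurable_funM.
- apply: measurable_funM => //.
  have -> : (fun x => \1_[set b' | posdefmx (Hm (W x) b')] (b x)) =
      (\1_((fun x => Hm (W x) (b x)) @^-1` [set A | posdefmx A]) : T -> R).
    by apply/funext => x; rewrite !indicE.
  apply: measurable_indic; rewrite -[X in measurable X]setTI.
  by apply: mH => //; exact: measurable_posdefmx.
- apply: (measurableT_comp (@measurable_expR R)).
  apply: measurable_funM => //; apply: measurable_funB.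
    by apply: measurable_funD; apply: measurable_fun_dotcV => //;
      apply: measurable_fun_mulmx => //; apply: measurable_fun_invmx.
  by apply: measurable_funM => //; exact: measurable_fun_dotcV.
- apply: measurable_fun_inv; apply: (measurable_fun_sqrt (f := fun x => \det (Hm (W x) (b x)))).
  exact: measurable_fun_det.
Qed.

End posdef.

(** * Lebesgue measure on column vectors *)

Section boxes.
Context {R : realType} (n : nat).

Definition boxes : set (set 'cV[R]_n) :=
  [set E | exists2 A : 'I_n -> set R, (forall i, measurable (A i)) &
    E = [set v : 'cV[R]_n | forall i, A i (v i ord0)]].

Lemma boxE (A : 'I_n -> set R) : [set v : 'cV[R]_n | forall i, A i (v i ord0)] =
  \bigcap_(i in [set: 'I_n]) (fun v : 'cV[R]_n => v i ord0) @^-1` A i.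
Proof.
by apply/seteqP; split=> [v Av i _|v Av i]; [exact: Av|exact: (Av i I)].
Qed.

Lemma measurable_box (A : 'I_n -> set R) : (forall i, measurable (A i)) ->
  measurable [set v : 'cV[R]_n | forall i, A i (v i ord0)].
Proof.
move=> mA; rewrite boxE; apply: fin_bigcap_measurable => // i _.
by rewrite -[X in measurable X]setTI; exact: measurable_entry.
Qed.

Lemma measurable_boxes : @measurable _ 'cV[R]_n = <<s boxes >>.
Proof.
apply/seteqP; split; last first.
  apply: smallest_sub; first exact: sigma_algebra_measurable.
  by move=> _ [A mA ->]; exact: measurable_box.
rewrite /measurable/=; apply: smallest_sub; first exact: smallest_sigma_algebra.
move=> _ [i [j [Y mY ->]]]; apply: sub_sigma_algebra.
exists (fun k => if k == i then Y else setT) => [k|].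
  by case: ifP.
apply/seteqP; split=> v /=; rewrite !ord1.
  by move=> Yv k; case: eqP => // ->.
by move/(_ i); rewrite eqxx.
Qed.

Lemma boxes_setI : setI_closed boxes.
Proof.
move=> _ _ [A mA ->] [B mB ->]; exists (fun i => A i `&` B i).
  by move=> i; exact: measurableI.
by apply/seteqP; split=> [v [Av Bv] i|v ABv]; [split|split=> i; have [] := ABv i].
Qed.

(** Boxes form a generating pi-system, and the cubes [-k, k]^n exhaust the space;
    hence the value on boxes identifies Lebesgue measure under any relabelling or
    translation of the coordinates. *)
Lemma measure_boxes_unique (mu nu : {measure set 'cV[R]_n -> \bar R}) :
  (forall A : 'I_n -> set R, (forall i, measurable (A i)) ->
    nu [set v : 'cV[R]_n | forall i, A i (v i ord0)] =
    (\prod_(i < n) lebesgue_measure (A i : set (measurableTypeR R)))%E) ->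
  (forall A : 'I_n -> set R, (forall i, measurable (A i)) ->
    mu [set v : 'cV[R]_n | forall i, A i (v i ord0)] =
    (\prod_(i < n) lebesgue_measure (A i : set (measurableTypeR R)))%E) ->
  forall E, measurable E -> mu E = nu E.
Proof.
move=> nuE muE E mE.
pose g k := [set v : 'cV[R]_n | forall i, `[- k%:R, k%:R]%classic (v i ord0)].
apply: (measure_unique boxes g _ _ _ _ mu nu _ _ E mE) => //.
- exact: measurable_boxes.
- exact: boxes_setI.
- by move=> k; exists (fun=> `[- k%:R, k%:R]%classic).
- apply/seteqP; split => // v _.
  exists (Num.truncn (\sum_i `|v i ord0|)).+1 => // i /=.
  rewrite in_itv/= -ler_norml (le_trans _ (ltW (truncnS_gt _)))//.
  by rewrite (bigD1 i)//= lerDl sumr_ge0.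
- by move=> _ [A mA ->]; rewrite muE// nuE.
- move=> k; rewrite /g (muE (fun=> `[- k%:R, k%:R]%classic))// ltey_eq; apply/orP; left.
  apply: (big_ind (fun x : \bar R => x \is a fin_num)) => // [x y|i _].
    exact: fin_numM.
  by rewrite lebesgue_measure_itv/=; case: ifP.
Qed.

End boxes.

Section split.
Context {R : realType} (n m p : nat) (r : 'I_n -> 'I_(m + p)).
Hypothesis bij_r : bijective r.

(** A vector over 'I_n given by two blocks of coordinates; r says where in the
    concatenation each coordinate of 'I_n is found. *)
Definition glue (z : 'cV[R]_m * 'cV[R]_p) : 'cV[R]_n := rowsub r (col_mx z.1 z.2).

Lemma measurable_glue : measurable_fun setT glue.
Proof.
apply/measurable_fun_mxP => i j; under eq_fun do rewrite mxE.
case: (split_ordP (r i)) => k ->.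
- under eq_fun do rewrite col_mxEu.
  exact: (measurableT_comp (measurable_entry _ _)).
- under eq_fun do rewrite col_mxEd.
  exact: (measurableT_comp (measurable_entry _ _)).
Qed.

Lemma lebesgue_cV_glue (A : set 'cV[R]_n) : measurable A ->
  lebesgue_cV n A =
  pushforward (lebesgue_cV m \x lebesgue_cV p)%E glue A.
Proof.
move=> mA; have [r' rK r'K] := bij_r.
apply: (measure_boxes_unique (nu := pushforward (lebesgue_cV m \x lebesgue_cV p)%E glue)) => //.
- exact: measurable_glue.
- move=> ? B mB; rewrite [RHS](reindex r')/=; last by exists r => i _.
  rewrite big_split_ord/= -!lebesgue_cV_box// -product_measure1E; last 2 first.
  + exact: (measurable_box (fun i => mB _)).
  + exact: (measurable_box (fun i => mB _)).
  congr ((_ \x _)%E _); apply/seteqP; split => [[u v] /= Auv|[u v] /= [Au Av] i].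
    split=> i.
      by have := Auv (r' (lshift p i)); rewrite mxE r'K col_mxEu.
    by have := Auv (r' (rshift m i)); rewrite mxE r'K col_mxEd.
  rewrite mxE -[i]rK; case: (split_ordP (r i)) => k ->; rewrite r'K.
    by rewrite col_mxEu; exact: Au.
  by rewrite col_mxEd; exact: Av.
- exact: lebesgue_cV_box.
Qed.

Lemma integral_cV_glue (f : 'cV[R]_n -> R) : measurable_fun setT f ->
  (forall x, 0 <= f x) ->
  (\int[lebesgue_cV n]_x (f x)%:E =
   \int[lebesgue_cV m]_u \int[lebesgue_cV p]_v (f (glue (u, v)))%:E)%E.
Proof.
move=> mf f0; rewrite (eq_measure_integral
  (pushforward (lebesgue_cV m \x lebesgue_cV p)%E glue)); last first.
- by move=> ? A mA _; exact: lebesgue_cV_glue.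
- move=> mg; rewrite ge0_integral_pushforward//; last 2 first.
  + exact/measurable_EFinP.
  + by move=> y _; rewrite lee_fin.
  rewrite preimage_setT fubini_tonelli1//=.
  + by apply/measurable_EFinP; apply: measurableT_comp.
  + by move=> z; rewrite lee_fin.
- exact: measurable_glue.
Qed.

End split.

Section translation.
Context {R : realType}.

Lemma lebesgue_measure_shift (c : R) (A : set (measurableTypeR R)) : measurable A ->
  lebesgue_measure A = lebesgue_measure ((fun x => x + c) @^-1` A).
Proof.
move=> mA.
apply: (lebesgue_measure_unique (mu := pushforward lebesgue_measure
  ((fun x : R => x + c) : measurableTypeR R -> measurableTypeR R))) => //=.
  exact: measurable_funD.
move=> ? _ [[a b]] _ <-; rewrite /pushforward.
rewrite (_ : _ @^-1` _ = `]a - c, b - c]%classic); last first.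
  by apply/seteqP; split => x /=; rewrite !in_itv/= ltrBlDr lerBrDr.
rewrite !lebesgue_measure_itv/= !lte_fin ltrD2r; case: ifP => // _.
by rewrite -!EFinB; congr EFin; ring.
Qed.

Lemma integral_cV_shift n (c : 'cV[R]_n) (f : 'cV[R]_n -> R) :
  measurable_fun setT f -> (forall x, 0 <= f x) ->
  (\int[lebesgue_cV n]_x (f (x + c))%:E = \int[lebesgue_cV n]_x (f x)%:E)%E.
Proof.
move=> mf f0; pose t (x : 'cV[R]_n) := x + c.
have mt : measurable_fun setT t.
  apply/measurable_fun_mxP => i j; under eq_fun do rewrite mxE.
  by apply: measurable_funD => //; exact: measurable_entry.
rewrite [RHS](eq_measure_integral (pushforward (lebesgue_cV n) t)) //; last first.
  move=> E mE _.
  apply: (measure_boxes_unique (nu := pushforward (lebesgue_cV n) t)) => //.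
  - move=> A mA; transitivity (lebesgue_cV n [set v : 'cV[R]_n | forall i,
        ((fun x => x + c i ord0) @^-1` A i) (v i ord0)]).
      congr (lebesgue_cV n _); apply/seteqP.
      by split => v /= Av i; have := Av i; rewrite /t mxE.
    rewrite (lebesgue_cV_box (A := fun i => (fun x => x + c i ord0) @^-1` A i)); last first.
      move=> i; rewrite -[X in measurable X]setTI.
      have /(_ measurableT _ (mA i)) : measurable_fun setT (fun x : R => x + c i ord0).
        exact: measurable_funD.
      by apply.
    by apply: eq_bigr => i _; apply/esym/lebesgue_measure_shift; exact: mA.
  - exact: lebesgue_cV_box.
rewrite ge0_integral_pushforward//; first exact/measurable_EFinP.
by move=> x _; rewrite lee_fin.
Qed.

End translation.

(** * The one-vertex integral *)

Section gauss_cdf.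
Context {R : realType}.

Let s : R := Num.sqrt 2^-1.

Let s_neq0 : s != 0.
Proof. by rewrite gt_eqF// sqrtr_gt0. Qed.

Let pdfE x : normal_pdf 0 s x = (Num.sqrt pi)^-1 * expR (- x ^+ 2) :> R.
Proof.
rewrite normal_pdfE// /normal_peak /normal_fun subr0 sqr_sqrtr//.
by rewrite -mulrnAl -mulr_natr mulVf ?mul1r ?divr1.
Qed.

Let P := normal_prob 0 s.
Let X : measurableTypeR R -> R := idfun.

#[local] HB.instance Definition _ :=
  @isMeasurableFun.Build _ _ _ _ X (@measurable_id _ _ setT).

(** The distribution function of the centred normal law of variance 1/2. *)
Definition gauss_cdf (x : R) : R := fine (P `]-oo, x]%classic).

Lemma gauss_cdf_y : gauss_cdf x @[x --> +oo] --> (1 : R).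
Proof.
have /fine_cvg := @cvg_cdfy1 _ _ _ P (X : {RV P >-> R}).
by apply: cvg_trans; apply: near_eq_cvg; near=> x.
Unshelve. all: by end_near. Qed.

Lemma gauss_cdf_Ny : gauss_cdf x @[x --> -oo] --> (0 : R).
Proof.
have /fine_cvg := @cvg_cdfNy0 _ _ _ P (X : {RV P >-> R}).
by apply: cvg_trans; apply: near_eq_cvg; near=> x.
Unshelve. all: by end_near. Qed.

Lemma is_derive_gauss_cdf (x : R) :
  is_derive x 1 gauss_cdf ((Num.sqrt pi)^-1 * expR (- x ^+ 2)).
Proof.
rewrite -pdfE; set f := normal_pdf 0 s.
have x1 : x < x + 1 by rewrite ltrDl.
have fi : lebesgue_measure.-integrable [set` Interval -oo%O (BRight (x + 1))] (EFin \o f).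
  by apply: integrableS (integrable_normal_pdf 0 s).
have [| |dE E'] := continuous_FTC1 x1 fi.
- by rewrite ltNyr.
- by have := @continuous_normal_pdf R 0 s s_neq0; apply.
apply: (@DeriveDef _ _ _ x 1 gauss_cdf (f x) dE).
by rewrite -derive1E E'.
Qed.

End gauss_cdf.

Section inverse_gaussian.
Context {R : realType} (a : R).
Hypothesis a0 : 0 < a.

Let c : R := (Num.sqrt pi)^-1.

Let c0 : 0 < c.
Proof. by rewrite invr_gt0 sqrtr_gt0 pi_gt0. Qed.

(** The one-vertex density with boundary condition 2 a. For x <= 0 it vanishes
    because sqrt x, hence its inverse, is 0. *)
Definition inv_gauss (x : R) : R :=
  c * (Num.sqrt x)^-1 * expR (- (x + a ^+ 2 / x) + 2 * a).

(** With G the distribution function above, G (lo x) + e^(4 a) G (hi x) is an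
    antiderivative of the density: completing the square in both arguments gives
    the same Gaussian factor, and the derivatives of lo and hi add up to
    1 / sqrt x. The value of F at 0 is its limit from the right. *)
Let lo (x : R) := Num.sqrt x - a * (Num.sqrt x)^-1.
Let hi (x : R) := Num.sqrt x + a * (Num.sqrt x)^-1.

Let F (x : R) := if 0 < x then gauss_cdf (lo x) + expR (4 * a) * gauss_cdf (hi x)
                 else expR (4 * a).

Let sqrt_lt (x e : R) : 0 < e -> x < e ^+ 2 -> Num.sqrt x < e.
Proof.
move=> e0 xe; have [x0|x0] := leP x 0; first by rewrite ler0_sqrtr.
by rewrite -(ger0_norm (ltW e0)) -sqrtr_sqr ltr_sqrt// (lt_trans x0).
Qed.

Let sqrt_gt (x e : R) : 0 <= e -> e ^+ 2 < x -> e < Num.sqrt x.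
Proof.
by move=> e0 xe; rewrite -(ger0_norm e0) -sqrtr_sqr ltr_sqrt// (le_lt_trans _ xe)// sqr_ge0.
Qed.

(* near the origin both arguments are dominated by a / sqrt x *)
Let invsqrt_ge (A x : R) : 0 < x -> x < (a / (`|A| + 2)) ^+ 2 -> `|A| + 2 < a * (Num.sqrt x)^-1.
Proof.
move=> x0 xA; have A2 : 0 < `|A| + 2 by rewrite ltr_wpDl.
rewrite ltr_pdivlMr ?sqrtr_gt0// mulrC -ltr_pdivlMr//.
by apply: sqrt_lt => //; rewrite divr_gt0.
Qed.

Let cvg_hi0 : hi x @[x --> 0^'+] --> +oo.
Proof.
apply/cvgryPge => A; near=> x.
have x0 : 0 < x by [].
have : `|A| + 2 < a * (Num.sqrt x)^-1.
  apply: invsqrt_ge => //; near: x; apply: nbhs_right_lt.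
  by rewrite exprn_gt0// divr_gt0// ltr_wpDl.
have := ler_norm A; have := sqrtr_ge0 x; rewrite /hi; lra.
Unshelve. all: by end_near. Qed.

Let cvg_lo0 : lo x @[x --> 0^'+] --> -oo.
Proof.
apply/cvgrNyPle => A; near=> x.
have x0 : 0 < x by [].
have : `|A| + 2 < a * (Num.sqrt x)^-1.
  apply: invsqrt_ge => //; near: x; apply: nbhs_right_lt.
  by rewrite exprn_gt0// divr_gt0// ltr_wpDl.
have : Num.sqrt x < 1.
  by apply: sqrt_lt => //; rewrite expr1n; near: x; apply: nbhs_right_lt.
have := ler_norm (- A); rewrite normrN /lo; lra.
Unshelve. all: by end_near. Qed.

Let cvg_loy : lo x @[x --> +oo] --> +oo.
Proof.
apply/cvgryPge => A; near=> x.
have x1 : 1 < Num.sqrt x.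
  by apply: sqrt_gt => //; rewrite expr1n; near: x; apply: nbhs_pinfty_gt; exact: num_real.
have : `|A| + a < Num.sqrt x.
  apply: sqrt_gt; first by rewrite addr_ge0// ltW.
  by near: x; apply: nbhs_pinfty_gt; exact: num_real.
have : a * (Num.sqrt x)^-1 <= a.
  by rewrite ler_pdivrMr ?(lt_trans _ x1)// ler_peMr ?ltW.
have := ler_norm A; rewrite /lo; lra.
Unshelve. all: by end_near. Qed.

Let cvg_hiy : hi x @[x --> +oo] --> +oo.
Proof.
apply/cvgryPge => A; near=> x.
have : `|A| < Num.sqrt x by apply: sqrt_gt => //; near: x; apply: nbhs_pinfty_gt; exact: num_real.
have : 0 <= a * (Num.sqrt x)^-1 by rewrite mulr_ge0 ?invr_ge0// ltW.
have := ler_norm A; rewrite /hi; lra.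
Unshelve. all: by end_near. Qed.

Let is_derive_F (x : R) : 0 < x -> is_derive x 1 F (inv_gauss x).
Proof.
move=> x0; have q0 : 0 < Num.sqrt x by rewrite sqrtr_gt0.
have dq := is_derive1_sqrt x0.
have dV : is_derive x 1 (fun y => (Num.sqrt y)^-1) _ := is_deriveV (lt0r_neq0 q0) dq.
have daV : is_derive x 1 (fun y => a * (Num.sqrt y)^-1) _ :=
  is_deriveZ a dV.
have dlo : is_derive x 1 lo _ := is_deriveB dq daV.
have dhi : is_derive x 1 hi _ := is_deriveD dq daV.
have d1 := is_derive1_comp (is_derive_gauss_cdf (lo x)) dlo.
have d2 := is_derive1_comp (is_derive_gauss_cdf (hi x)) dhi.
have d3 : is_derive x 1 (fun y => gauss_cdf (lo y) + expR (4 * a) * gauss_cdf (hi y)) _ :=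
  is_deriveD d1 (is_deriveZ (expR (4 * a)) d2).
apply: (@near_eq_is_derive _ _ _ (fun y => gauss_cdf (lo y) + expR (4 * a) * gauss_cdf (hi y))).
  by near=> y; rewrite /F ifT//; near: y; exact: lt_nbhsr.
apply: is_derive_eq d3 _; rewrite /inv_gauss -/c /lo /hi /GRing.scale/=.
have -> : x = Num.sqrt x ^+ 2 by rewrite sqr_sqrtr// ltW.
rewrite sqrtr_sqr ger0_norm ?ltW//.
clear d1 d2 dlo dhi daV dV dq; move: (Num.sqrt x) q0 => q q0.
have qn := lt0r_neq0 q0.
have -> : - (q - a * q^-1) ^+ 2 = (- (q ^+ 2 + a ^+ 2 / q ^+ 2) + 2 * a) by field.
have -> : - (q + a * q^-1) ^+ 2 = (- (q ^+ 2 + a ^+ 2 / q ^+ 2) + 2 * a) - 4 * a by field.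
rewrite [expR (_ - 4 * a)]expRD expRN.
have := lt0r_neq0 (expR_gt0 (4 * a)); move: (expR (4 * a)) => e e0.
by move: (expR _) => E; field; rewrite qn e0.
Unshelve. all: by end_near. Qed.

Lemma inv_gauss_ge0 x : 0 <= inv_gauss x.
Proof. by rewrite /inv_gauss mulr_ge0 ?expR_ge0// mulr_ge0 ?invr_ge0// ltW. Qed.

Lemma integral_inv_gauss :
  (\int[lebesgue_measure]_(x in `[0%R, +oo[) (inv_gauss x)%:E = 1)%E.
Proof.
have F0 : F 0 = expR (4 * a) by rewrite /F ltxx.
rewrite (@ge0_continuous_FTC2y _ _ F 0 (1 + expR (4 * a))).
- by rewrite -EFinB F0 addrK.
- by move=> x _; exact: inv_gauss_ge0.
- apply/continuous_within_itvcyP; split.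
    move=> x; rewrite in_itv/= andbT => x0.
    have q0 : Num.sqrt x != 0 by rewrite gt_eqF// sqrtr_gt0.
    apply: cvgM; first apply: cvgM.
    + exact: cvg_cst.
    + by apply: cvgV => //; exact: sqrt_continuous.
    + apply: continuous_comp; last exact: continuous_expR.
      apply: cvgD; last exact: cvg_cst.
      apply: cvgN; apply: cvgD; first exact: cvg_id.
      apply: cvgM; first exact: cvg_cst.
      by apply: cvgV; [rewrite gt_eqF|exact: cvg_id].
  have -> : inv_gauss 0 = 0 by rewrite /inv_gauss sqrtr0 invr0 mulr0 mul0r.
  (* exp (- a^2 / x) <= x / a^2 beats the singularity of 1 / sqrt x *)
  apply: (@squeeze_cvgr _ _ _ _ (fun=> 0)
      (fun x => (c * expR (2 * a) * a ^- 2) * Num.sqrt x)).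
  + near=> x; rewrite inv_gauss_ge0/=.
    have x0 : 0 < x by [].
    have q0 : 0 < Num.sqrt x by rewrite sqrtr_gt0.
    rewrite /inv_gauss expRD opprD expRD.
    have ex : expR (- x) <= 1 by rewrite -expR0 ler_expR oppr_le0 ltW.
    have ea : expR (- (a ^+ 2 / x)) <= a ^- 2 * Num.sqrt x ^+ 2.
      rewrite sqr_sqrtr ?(ltW x0)// -[X in _ <= X]invrK expRN lef_pV2 ?posrE ?expR_gt0//.
        by rewrite invfM invrK (le_trans _ (expR_ge1Dx _))// ler_wpDl.
      by rewrite invr_gt0 mulr_gt0 ?invr_gt0 ?exprn_gt0.
    have -> : c * expR (2 * a) * a ^- 2 * Num.sqrt x =
      c * (Num.sqrt x)^-1 * (1 * (a ^- 2 * Num.sqrt x ^+ 2) * expR (2 * a)).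
      by field; rewrite gt_eqF// gt_eqF.
    apply: ler_wpM2l; first by rewrite mulr_ge0 ?invr_ge0// ltW.
    by apply: ler_wpM2r; rewrite ?expR_ge0// ler_pM ?expR_ge0.
  + exact: cvg_cst.
  + rewrite -[X in _ --> X](mulr0 (c * expR (2 * a) * a ^- 2)).
    apply: cvgM; first exact: cvg_cst.
    rewrite -[X in _ --> X](@sqrtr0 R); apply: cvg_at_right_filter.
    exact: sqrt_continuous.
- apply: (@cvg_trans _ ((gauss_cdf (lo x) + expR (4 * a) * gauss_cdf (hi x)) @[x --> +oo])).
    by apply: near_eq_cvg; near=> x; rewrite /F ifT//.
  apply: cvgD; first exact: cvg_comp cvg_loy gauss_cdf_y.
  rewrite -[X in _ --> X]mulr1; apply: cvgM; first exact: cvg_cst.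
  exact: cvg_comp cvg_hiy gauss_cdf_y.
- by move=> x x0; have [] := is_derive_F x0.
- have : gauss_cdf (lo x) + expR (4 * a) * gauss_cdf (hi x) @[x --> 0^'+] -->
      0 + expR (4 * a) * 1.
    apply: cvgD; first exact: cvg_comp cvg_lo0 gauss_cdf_Ny.
    apply: cvgM; first exact: cvg_cst.
    exact: cvg_comp cvg_hi0 gauss_cdf_y.
  rewrite add0r mulr1 F0; apply: cvg_trans.
  by apply: near_eq_cvg; near=> x; rewrite /F ifT//.
- move=> x; rewrite in_itv/= andbT => x0.
  by have [_ <-] := is_derive_F x0; rewrite derive1E.
Unshelve. all: by end_near. Qed.

End inverse_gaussian.

(** * The partition function *)

Section normalisation.
Context {R : realType}.

Lemma integral_cV1 (f : 'cV[R]_1 -> R) : measurable_fun setT f ->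
  (forall v, 0 <= f v) ->
  (\int[lebesgue_cV 1]_v (f v)%:E =
   \int[lebesgue_measure]_x (f (const_mx x))%:E)%E.
Proof.
move=> mf f0.
have mc := @measurable_cons_col R 0.
rewrite (eq_measure_integral (pushforward
  (lebesgue_measure \x (lebesgue_cV 0))%E (@cons_col R 0))) //.
rewrite ge0_integral_pushforward//; last 2 first.
- exact/measurable_EFinP.
- by move=> v _; rewrite lee_fin.
rewrite preimage_setT fubini_tonelli1//=; last 2 first.
- by apply/measurable_EFinP; apply: measurableT_comp.
- by move=> z; rewrite lee_fin.
apply: eq_integral => x _; rewrite /fubini_F integral_dirac//=.
- rewrite diracT mul1e; congr (f _)%:E.
  apply/matrixP => i j; rewrite !ord1 [RHS]mxE; exact: cons_col0.
- apply/measurable_EFinP; apply: measurableT_comp => //.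
  by apply: measurableT_comp => //; exact: measurable_pair1.
Qed.

Lemma const_mx1 (x : R) : const_mx x = x%:M :> 'M[R]_1.
Proof. by apply/matrixP => i j; rewrite !ord1 !mxE eqxx. Qed.

Lemma Hm1 (W : 'M[R]_1) x : Hm W (const_mx x) = (2 * x)%:M.
Proof. by apply/matrixP => i j; rewrite !ord1 !mxE eqxx. Qed.

Lemma invmx_scalar1 (x : R) : invmx (x%:M) = (x^-1)%:M :> 'M[R]_1.
Proof.
have [->|x0] := eqVneq x 0; last first.
  by apply: invmx_uniq; rewrite -scalar_mxM mulfV.
by rewrite invr0 /invmx unitmxE det_scalar1 unitr0.
Qed.

Lemma dens1E (W : 'M[R]_1) (h x : R) : 0 < h ->
  dens W (const_mx h) (const_mx x) = inv_gauss (h / 2) x.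
Proof.
move=> h0; have [x0|x0] := leP x 0.
  rewrite /inv_gauss (ler0_sqrtr x0) invr0 mulr0 mul0r dens0// Hm1.
  by rewrite posdefmx_scalar; apply/negP; rewrite -leNgt pmulr_rle0.
rewrite densE Hm1; last by rewrite posdefmx_scalar mulr_gt0.
rewrite expr1 det_scalar1 invmx_scalar1 !const_mx1 -!scalar_mxM.
have dE (y z : R) : dotcV (y%:M : 'cV[R]_1) z%:M = y * z.
  by rewrite /dotcV big_ord1 !mxE eqxx.
rewrite !dE /inv_gauss mulrAC; congr (_ * expR _); last by field; rewrite gt_eqF.
rewrite sqrtrM// sqrtrV ?pi_ge0// [Num.sqrt (2 * x)]sqrtrM//.
by field; rewrite !gt_eqF ?sqrtr_gt0 ?pi_gt0.
Qed.

Lemma integral_dens1 (W : 'M[R]_1) (eta : 'cV[R]_1) :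
  0 < eta ord0 ord0 -> (\int[lebesgue_cV 1]_b (dens W eta b)%:E = 1)%E.
Proof.
move=> h0; rewrite integral_cV1; last 2 first.
- exact: measurable_dens.
- by move=> v; exact: dens_ge0.
have -> : eta = const_mx (eta ord0 ord0).
  by apply/matrixP => i j; rewrite !ord1 mxE.
under eq_integral do rewrite dens1E//.
set a := (_ / 2).
have a0 : 0 < a by rewrite divr_gt0.
rewrite -(integral_inv_gauss a0) [RHS]integral_mkcond.
apply: eq_integral => x _; rewrite patchE; case: ifPn => //.
rewrite notin_setE/= in_itv/= andbT => /negP; rewrite -ltNge => x0.
by rewrite /inv_gauss (ler0_sqrtr (ltW x0)) invr0 mulr0 mul0r.
Qed.

(** The partition function. The first vertex u is integrated last: given u, the
    remaining coordinates have, up to a translation, a density of the same family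
    and the induction hypothesis applies; what is left is a one-vertex density.
    Positivity of eta keeps all boundary conditions met on the way positive. *)
Lemma integral_dens n (W : 'M[R]_n) (eta : 'cV[R]_n) :
  W^T = W -> (forall i j, 0 <= W i j) -> (forall i, 0 < eta i ord0) ->
  (\int[lebesgue_cV n]_b (dens W eta b)%:E = 1)%E.
Proof.
elim: n W eta => [|n IHn] W eta sW W0 eta0.
  rewrite /= integral_dirac//; last by apply/measurable_EFinP; exact: measurable_dens.
  rewrite [X in (X * _)%E](_ : _ = 1%E) ?mul1e /dens; last exact: diracT.
  rewrite indicE mem_set/=; last by split=> [|x]; [apply/matrixP => -[]|rewrite [x]flatmx0 eqxx].
  by rewrite det_mx00 sqrtr1 invr1 expr0 !mulr1 /dotcV !big_ord0 addr0 mulr0 subrr mulr0 expR0 mulr1.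
pose W' : 'M[R]_(1 + n) := W.
pose A := ulsubmx W'; pose w := ursubmx W'; pose D := drsubmx W'.
have WE : W' = block_mx A w w^T D by rewrite trmx_ursub [W'^T]sW submxK.
have sA : A^T = A by rewrite trmx_ulsub sW.
have w0 i j : 0 <= w i j by rewrite !mxE.
pose eu : 'cV[R]_1 := usubmx (eta : 'cV[R]_(1 + n)).
pose ed : 'cV[R]_n := dsubmx (eta : 'cV[R]_(1 + n)).
have etaE : eta = col_mx eu ed by rewrite [RHS]vsubmxK.
have bij_id : bijective (id : 'I_(1 + n) -> 'I_(1 + n)) by exists id.
have md : measurable_fun setT (@dens R (1 + n) W' eta) by exact: measurable_dens.
rewrite (integral_cV_glue bij_id md); last by move=> x; exact: dens_ge0.
transitivity (\int[lebesgue_cV 1]_u (dens A (eu + w *m const_mx 1) u)%:E)%E.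
  apply: eq_integral => u _.
  have gE v : @glue R _ 1 n id (u, v) = col_mx u v.
    by apply/matrixP => i j; rewrite [LHS]mxE.
  have dE v := dens_block w D eu ed u v sA.
  rewrite -WE -etaE in dE.
  under eq_integral => v _ do rewrite gE dE.
  have [pA|npA] := pselect (posdefmx (Hm A u)); last first.
    by rewrite dens0//; apply: integral0_eq => v _; rewrite mul0r.
  under eq_integral => v _ do rewrite EFinM.
  rewrite ge0_integralZl//; last 3 first.
  - by apply/measurable_EFinP; apply: measurable_dens => //; apply: measurable_fun_addmx.
  - by move=> v _; rewrite lee_fin dens_ge0.
  - by rewrite lee_fin dens_ge0.
  set W2 := D + _; set eta2 := ed + _.
  rewrite (integral_cV_shift (- _) (f := dens W2 eta2)); last 2 first.
  - exact: measurable_dens.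
  - by move=> v; exact: dens_ge0.
  have uE : u = const_mx (u ord0 ord0).
    by apply/matrixP => i j; rewrite !ord1 mxE.
  have HE : Hm A u = (2 * u ord0 ord0)%:M by rewrite {1}uE Hm1.
  have G0 i j : 0 <= invmx (Hm A u) i j.
    rewrite HE invmx_scalar1 !ord1 mxE eqxx invr_ge0.
    by move: pA; rewrite HE posdefmx_scalar => /ltW.
  have wG0 i j : 0 <= (w^T *m invmx (Hm A u)) i j.
    by rewrite mxE sumr_ge0// => k _; rewrite mulr_ge0// mxE.
  rewrite IHn ?mule1//.
  - rewrite linearD/= !trmx_mul trmxK trmx_inv Hm_sym// mulmxA.
    by rewrite trmx_drsub sW.
  - move=> i j; rewrite mxE addr_ge0//; first by rewrite !mxE.
    by rewrite mxE sumr_ge0// => k _; rewrite mulr_ge0.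
  - move=> i; rewrite mxE ltr_pwDl//; first by rewrite mxE.
    by rewrite mxE sumr_ge0// => k _; rewrite mulr_ge0// mxE ltW.
apply: integral_dens1; rewrite mxE ltr_pwDl//; first by rewrite mxE.
by rewrite mxE sumr_ge0// => k _; rewrite mulr_ge0// mxE.
Qed.

End normalisation.

(** * Uniqueness of the Laplace transform on the half-line *)

Section laplace.
Context {R : realType}.

Lemma bernoulli_ge (z : R) N : 0 <= z <= 1 -> 1 - N%:R * z <= (1 - z) ^+ N.
Proof.
move=> /andP[z0 z1]; elim: N => [|N IHN]; first by rewrite mul0r subr0 expr0.
rewrite exprS; apply: (@le_trans _ _ ((1 - z) * (1 - N%:R * z))); last first.
  by apply: ler_wpM2l => //; rewrite subr_ge0.
by rewrite -natr1; have := ler0n R N; nra.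
Qed.

Lemma cvg_natmul_expr (r : R) : 0 <= r < 1 -> (n%:R * r ^+ n) @[n --> \oo] --> 0.
Proof.
(* s^2 >= r, so that n r^n <= (n s^n) s^n, and n s^n is bounded by 1 / h *)
move=> /andP[r0 r1]; pose s := (1 + r) / 2; pose h := s^-1 - 1.
have s0 : 0 < s by rewrite /s; lra.
have s1 : s < 1 by rewrite /s; lra.
have h0 : 0 < h by rewrite subr_gt0 invf_gt1.
have rs : r <= s ^+ 2 by rewrite /s; nra.
have ns n : n%:R * s ^+ n <= h^-1.
  have : 1 + n%:R * h <= s^-1 ^+ n.
    rewrite (_ : s^-1 = 1 + h); last by rewrite addrC subrK.
    elim: n => [|n IHn]; first by rewrite mul0r addr0 expr0.
    rewrite exprS; apply: (@le_trans _ _ ((1 + h) * (1 + n%:R * h))).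
      by rewrite -natr1; have := ler0n R n; nra.
    by apply: ler_wpM2l => //; rewrite addr_ge0 ?ltW.
  have sn0 : 0 < s ^+ n by rewrite exprn_gt0.
  rewrite exprVn -[(s ^+ n)^-1]div1r ler_pdivlMr// => H.
  by rewrite -[h^-1]div1r ler_pdivlMr//; nra.
apply: (@squeeze_cvgr _ _ _ _ (fun=> 0) (fun n => h^-1 * s ^+ n)).
- apply: nearW => n; rewrite mulr_ge0 ?exprn_ge0//=.
  apply: (@le_trans _ _ (n%:R * (s ^+ 2) ^+ n)).
    by apply: ler_wpM2l => //; apply: lerXn2r; rewrite ?nnegrE ?sqr_ge0.
  rewrite -exprM mulnC exprM expr2 mulrA.
  by apply: ler_wpM2r; [rewrite exprn_ge0 ?ltW|exact: ns].
- exact: cvg_cst.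
- rewrite -[X in _ --> X](mulr0 (h^-1 : R)); apply: cvgM; first exact: cvg_cst.
  by apply: cvg_expr; rewrite ger0_norm ?ltW.
Qed.

(** Polynomials in exp (- l n x) that converge to the indicator of l x > ln 2.
    The factor n in the exponent n 2^n makes the limit 0 on the boundary too. *)
Let phi (l : R) n (x : R) : R := (1 - expR (- (l * x)) ^+ n) ^+ (n * 2 ^ n).

Lemma cvg_phi_gt (l x : R) : ln 2 < l * x -> phi l n x @[n --> \oo] --> (1 : R).
Proof.
move=> lx; set y := expR (- (l * x)).
have y0 : 0 < y by exact: expR_gt0.
have y2 : 2 * y < 1.
  by rewrite /y expRN mulrC ltr_pdivrMl ?expR_gt0// mulr1 -[ltLHS]lnK ?posrE// ltr_expR.
apply: (@squeeze_cvgr _ _ _ _ (fun n => 1 - n%:R * (2 * y) ^+ n) (fun=> 1)).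
- apply: nearW => n; rewrite /phi -/y.
  have yn0 : 0 <= y ^+ n by rewrite exprn_ge0// ltW.
  have yn1 : y ^+ n <= 1 by rewrite exprn_ile1//; lra.
  have yn : 0 <= y ^+ n <= 1 by rewrite yn0.
  rewrite [X in _ && X]exprn_ile1 ?andbT ?subr_ge0//; last by rewrite lerBlDr lerDl.
  have := bernoulli_ge (n * 2 ^ n) yn.
  by rewrite natrM natrX exprMn mulrA.
- rewrite -[X in _ --> X]subr0; apply: cvgB; first exact: cvg_cst.
  by apply: cvg_natmul_expr; rewrite y2 mulr_ge0 ?ltW.
- exact: cvg_cst.
Qed.

Lemma cvg_phi_le (l x : R) : 0 <= l * x -> l * x <= ln 2 -> phi l n x @[n --> \oo] --> (0 : R).
Proof.
move=> lx0 lx; set y := expR (- (l * x)).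
have y0 : 0 < y by exact: expR_gt0.
have y1 : y <= 1 by rewrite -expR0 ler_expR oppr_le0.
have y2 : 1 <= 2 * y.
  by rewrite /y expRN mulrC ler_pdivlMl ?expR_gt0// mulr1 -[leRHS]lnK ?posrE// ler_expR.
apply: (@squeeze_cvgr _ _ _ _ (fun=> 0) (fun n => expR (- 1) ^+ n)).
- apply: nearW => n; rewrite /phi -/y.
  have yn0 : 0 <= y ^+ n by rewrite exprn_ge0// ltW.
  have yn1 : y ^+ n <= 1 by rewrite exprn_ile1// ltW.
  rewrite exprn_ge0 ?subr_ge0//=.
  apply: (@le_trans _ _ (expR (- y ^+ n) ^+ (n * 2 ^ n))).
    by apply: lerXn2r; rewrite ?nnegrE ?subr_ge0 ?expR_ge0// expR_ge1Dx.
  rewrite -[expR (- y ^+ n) ^+ _]expRM_natl -[expR (- 1) ^+ n]expRM_natl ler_expR.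
  rewrite natrM natrX mulrN mulrN1 lerN2 -mulrA -exprMn.
  by rewrite ler_peMr// exprn_ege1.
- exact: cvg_cst.
- by apply: cvg_expr; rewrite ger0_norm ?expR_ge0// expRN invf_lt1 ?expR_gt0// expR_gt1.
Qed.

Local Notation D := (`]0, +oo[%classic : set (measurableTypeR R)).

Definition laplace (m : {measure set (measurableTypeR R) -> \bar R}) (l : R) : \bar R :=
  (\int[m]_(x in D) (expR (- (l * x)))%:E)%E.

Section one_measure.
Variable m : {measure set (measurableTypeR R) -> \bar R}.
Hypothesis moo : (m D < +oo)%E.

Let mD : measurable D. Proof. exact: measurable_itv. Qed.

Let mexp (l : R) : measurable_fun setT (fun x : measurableTypeR R => expR (- (l * x)) : R).
Proof.
apply: (measurableT_comp (@measurable_expR R)).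
by apply: measurable_funN; apply: measurable_funM.
Qed.

Let exp_le1 (l x : R) : 0 <= l -> D x -> 0 <= expR (- (l * x)) <= 1.
Proof.
rewrite /= in_itv/= andbT => l0 x0.
by rewrite expR_ge0/= -expR0 ler_expR oppr_le0 mulr_ge0// ltW.
Qed.

Let integrable_cst (r : R) : m.-integrable D (EFin \o cst r).
Proof.
apply: measurable_bounded_integrable => //.
exists `|r|; split; first exact: num_real.
by move=> M rM x _; exact: ltW.
Qed.

Let integrable_exp (l : R) : 0 <= l ->
  m.-integrable D (fun x => (expR (- (l * x)))%:E).
Proof.
move=> l0; apply: (le_integrable mD _ _ (integrable_cst 1)).
  by apply/measurable_EFinP; exact: measurable_funTS.
move=> x Dx; have /andP[e0 e1] := exp_le1 l0 Dx.
by rewrite /= lee_fin normr1 ger0_norm.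
Qed.

Lemma integral_phi (l : R) n : 0 <= l ->
  (\int[m]_(x in D) (phi l n x)%:E =
   \sum_(i < (n * 2 ^ n).+1)
     ((-1) ^+ i *+ 'C(n * 2 ^ n, i))%:E * laplace m ((n * i)%:R * l))%E.
Proof.
move=> l0; have pE (x : R) : phi l n x = \sum_(i < (n * 2 ^ n).+1)
    ((-1) ^+ i *+ 'C(n * 2 ^ n, i)) * expR (- ((n * i)%:R * l * x)).
  rewrite /phi exprBn; apply: eq_bigr => i _.
  by rewrite expr1n mulr1 -exprM -expRM_natl mulrN -mulrA mulrnAl.
under eq_integral => x _ do rewrite pE -sumEFin.
have l0' i : 0 <= (n * i)%:R * l by rewrite mulr_ge0.
have intf i : m.-integrable D (fun x => ((-1) ^+ i *+ 'C(n * 2 ^ n, i))%:E *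
    (expR (- ((n * i)%:R * l * x)))%:E)%E.
  by apply: integrableZl => //; exact: integrable_exp.
under eq_integral do under eq_bigr do rewrite EFinM.
rewrite (integral_sum mD (fun i : 'I_(n * 2 ^ n).+1 => intf i)).
by apply: eq_bigr => i _; rewrite integralZl//; exact: integrable_exp.
Qed.

Lemma cvg_integral_phi (l : R) : 0 < l ->
  (\int[m]_(x in D) (phi l n x)%:E @[n --> \oo] -->
   m (`](ln 2 / l)%R, +oo[%classic : set (measurableTypeR R)))%E.
Proof.
move=> l0; pose A : set (measurableTypeR R) := `]ln 2 / l, +oo[%classic.
have mA : measurable A by exact: measurable_itv.
have DA : A `<=` D.
  move=> x; rewrite /A /= !in_itv/= !andbT; apply: lt_trans.
  by rewrite divr_gt0// ln_gt0// ltr1n.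
have -> : m A = (\int[m]_(x in D) (\1_A x)%:E)%E.
  by rewrite integral_indic// setIidl.
have mphi n : measurable_fun D (fun x => (phi l n x)%:E).
  apply/measurable_EFinP/measurable_funTS/measurable_funX.
  by apply: measurable_funB => //; exact: measurable_funX.
have cphi : {ae m, forall x, D x -> (phi l n x)%:E @[n --> \oo] --> (\1_A x)%:E}.
  apply: aeW => x; rewrite /= in_itv/= andbT => x0; apply: cvg_EFin; first by apply: nearW.
  rewrite indicE; case: (boolP (x \in A)) => [|].
    rewrite inE /A/= in_itv/= andbT ltr_pdivrMr// mulrC; exact: cvg_phi_gt.
  rewrite notin_setE /A/= in_itv/= andbT => /negP.
  rewrite -leNgt ler_pdivlMr// mulrC => lx.
  by apply: cvg_phi_le => //; rewrite mulr_ge0 ?ltW.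
have dphi : {ae m, forall x n, D x -> (`|(phi l n x)%:E| <= (EFin \o cst 1%R) x)%E}.
  apply: aeW => x n Dx; have /andP[e0 e1] := exp_le1 (ltW l0) Dx.
  rewrite /= lee_fin ger0_norm.
    by rewrite exprn_ile1 ?subr_ge0 ?exprn_ile1// lerBlDr lerDl exprn_ge0.
  by rewrite exprn_ge0// subr_ge0 exprn_ile1.
have mA1 : measurable_fun D (fun x => (\1_A x)%:E : \bar R).
  by apply/measurable_EFinP; exact/measurable_indic.
have [_ _] := dominated_convergence mD mphi mA1 cphi (integrable_cst 1) dphi.
exact.
Qed.

Lemma laplace0 : laplace m 0 = m D.
Proof.
rewrite /laplace; under eq_integral do rewrite mul0r oppr0 expR0.
by rewrite integral_cst// mul1e.
Qed.

End one_measure.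

(** The Laplace transforms give the integrals of phi l n, whose limits are the
    masses of all the half-lines ]t, +oo[ with t > 0, where l = ln 2 / t. *)
Theorem laplace_unique (mu nu : {measure set (measurableTypeR R) -> \bar R}) :
  (mu D < +oo)%E -> mu (~` D) = 0%E -> nu (~` D) = 0%E ->
  (forall l, 0 <= l -> laplace mu l = laplace nu l) ->
  forall A, measurable A -> mu A = nu A.
Proof.
move=> muoo muD nuD lE A mA.
have muDE : mu D = nu D by rewrite -!laplace0 lE.
have nuoo : (nu D < +oo)%E by rewrite -muDE.
have mD : measurable D by exact: measurable_itv.
have DE (m : {measure set (measurableTypeR R) -> \bar R}) B :
    m (~` D) = 0%E -> measurable B -> m B = m (B `&` D).
  move=> m0 mB; apply/eqP; rewrite eq_le; apply/andP; split; last first.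
    by apply: le_measure; rewrite ?inE//; exact: measurableI.
  have mDc : measurable (~` D) by exact: measurableC.
  rewrite -[leLHS](_ : m ((B `&` D) `|` (B `&` ~` D)) = _); last first.
    by rewrite -setIUr setUv setIT.
  apply: (le_trans (measureU2 _ _ _)); [exact: measurableI|exact: measurableI|].
  rewrite -[leRHS]adde0 leeD2l// -m0; apply: le_measure; rewrite ?inE//.
  exact: measurableI.
refine (@measure_unique _ R (measurableTypeR R) (@RGenOInfty.G R)
  (fun k => `](- k%:R)%R, +oo[%classic) _ _ _ _ mu nu _ _ A mA) => //.
- exact: RGenOInfty.measurableE.
- move=> _ _ [x ->] [y ->]; exists (Num.max x y).
  by apply/seteqP; split=> z /=; rewrite !in_itv/= !andbT gt_max; [move=> [-> ->]|case/andP].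
- by move=> k; exists (- k%:R).
- apply/seteqP; split => // x _; exists (Num.truncn `|x|).+1 => //=.
  rewrite in_itv/= andbT ltrNl (le_lt_trans (ler_norm _))// normrN.
  exact: truncnS_gt.
- move=> _ [x ->]; have mx : measurable (`]x, +oo[%classic : set (measurableTypeR R)).
    exact: measurable_itv.
  have [x0|x0] := leP x 0.
    rewrite (DE mu)// (DE nu)// setIidr// => y /=; rewrite !in_itv/= !andbT.
    exact: le_lt_trans.
  have l0 : 0 < ln 2 / x by rewrite divr_gt0// ln_gt0// ltr1n.
  have := cvg_integral_phi muoo l0; have := cvg_integral_phi nuoo l0.
  have -> : ln 2 / (ln 2 / x) = x by field; rewrite !gt_eqF// ln_gt0// ltr1n.
  move=> cnu cmu; apply: (cvg_unique _ cmu) => //; apply: cvg_trans cnu; apply: near_eq_cvg; near=> n.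
  rewrite !integral_phi ?ltW//; apply: eq_bigr => i _.
  by rewrite lE// mulr_ge0// ltW.
- move=> k; have mk : measurable (`](- k%:R)%R, +oo[%classic : set (measurableTypeR R)).
    exact: measurable_itv.
  rewrite (DE mu)//; apply: le_lt_trans muoo; apply: le_measure; rewrite ?inE//.
  exact: measurableI.
Unshelve. all: by end_near. Qed.

End laplace.

(** * Images of measures with a density *)

Section law.
Local Open Scope ereal_scope.
Context d d' (T : measurableType d) (S : measurableType d') (R : realType).
Variables (mu : {measure set T -> \bar R}) (f : T -> R) (s : T -> S).
Hypotheses (mf : measurable_fun setT f) (f0 : forall x, (0 <= f x)%R).
Hypothesis ms : measurable_fun setT s.

Let law_fun (A : set S) : \bar R := \int[mu]_(x in s @^-1` A) (f x)%:E.

Let mpre (A : set S) : measurable A -> measurable (s @^-1` A).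
Proof. by move=> mA; rewrite -[X in measurable X]setTI; exact: ms. Qed.

Let law0 : law_fun set0 = 0.
Proof. by rewrite /law_fun preimage_set0 integral_set0. Qed.

Let law_ge0 A : 0 <= law_fun A.
Proof. by apply: integral_ge0 => x _; rewrite lee_fin. Qed.

Let law_sigma_additive : semi_sigma_additive law_fun.
Proof.
move=> F mF tF mUF; rewrite /law_fun preimage_bigcup ge0_integral_bigcup//=.
- by apply: is_cvg_ereal_nneg_natsum_cond => n _ _; exact: law_ge0.
- by move=> k; exact/mpre.
- by apply: measurable_funTS; exact/measurable_EFinP.
- by move=> x _; rewrite lee_fin.
- apply/trivIsetP => /= i j _ _ ij; rewrite -preimage_setI.
  by move/trivIsetP : tF => /(_ _ _ _ _ ij) ->//; rewrite preimage_set0.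
Qed.

(** The image under s of the measure with density f with respect to mu. *)
Definition law : {measure set S -> \bar R} :=
  HB.pack law_fun (isMeasure.Build _ _ _ law_fun law0 law_ge0 law_sigma_additive).

Lemma lawE A : law A = \int[mu]_(x in s @^-1` A) (f x)%:E.
Proof. by []. Qed.

Import HBNNSimple.

Let integral_law_indic (B : set S) : measurable B ->
  law B = \int[mu]_x ((\1_B (s x))%:E * (f x)%:E).
Proof.
move=> mB; rewrite lawE integral_mkcond; apply: eq_integral => x _.
rewrite patchE indicE.
have -> : (x \in s @^-1` B) = (s x \in B) by apply/idP/idP; rewrite !inE.
by case: (s x \in B); rewrite ?mul1e ?mul0e.
Qed.

Lemma ge0_integral_law (g : S -> \bar R) : measurable_fun setT g ->
  (forall y, 0 <= g y) ->
  \int[law]_y g y = \int[mu]_x (g (s x) * (f x)%:E).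
Proof.
move=> mg g0; pose h := nnsfun_approx measurableT mg.
have hg y : (EFin \o h n) y @[n --> \oo] --> g y.
  by apply: cvg_nnsfun_approx.
have hnd y : {homo (fun n => (h n y)%:E) : a b / (a <= b)%N >-> a <= b}.
  by move=> a b ab; rewrite lee_fin; exact/lefP/nd_nnsfun_approx.
have mhs n : measurable_fun setT (fun x => (h n (s x))%:E).
  by apply/measurable_EFinP; apply: measurableT_comp.
have mfE : measurable_fun setT (fun x => (f x)%:E) by exact/measurable_EFinP.
transitivity (limn (fun n => \int[law]_y (h n y)%:E)).
  rewrite -monotone_convergence//.
  - by apply: eq_integral => y _; apply/esym/cvg_lim => //; exact: hg.
  - by move=> n; exact/measurable_EFinP.
  - by move=> n y _; rewrite lee_fin.
transitivity (limn (fun n => \int[mu]_x ((h n (s x))%:E * (f x)%:E))); last first.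
  rewrite -monotone_convergence//.
  - apply: eq_integral => x _; apply/cvg_lim => //.
    by apply: cvgeZr => //; exact: hg.
  - by move=> n; exact: emeasurable_funM.
  - by move=> n x _; rewrite mule_ge0 ?lee_fin.
  - by move=> x _ a b ab; rewrite lee_wpmul2r ?lee_fin//; exact/lefP/nd_nnsfun_approx.
congr (limn _); apply/funext => n.
have -> : \int[law]_y (h n y)%:E =
    \sum_(r \in range (h n)) r%:E * law (h n @^-1` [set r]).
  by rewrite -[LHS]/(\int[law]_y (EFin \o h n) y) integralT_nnsfun sintegralE.
have mind r : measurable_fun setT
    (fun x => ((\1_(h n @^-1` [set r]) (s x))%:E * (f x)%:E : \bar R)).
  apply: emeasurable_funM => //; apply/measurable_EFinP.
  by apply: (measurableT_comp _ ms); exact: measurable_indic.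
transitivity (\int[mu]_x (\sum_(r \in range (h n))
    (r%:E * ((\1_(h n @^-1` [set r]) (s x))%:E * (f x)%:E)))); last first.
  apply: eq_integral => x _; rewrite [in RHS]fimfunE -fsumEFin//.
  rewrite ge0_mule_fsuml; last by move=> r; exact: nnfun_muleindic_ge0.
  by apply: eq_fsbigr => r _; rewrite EFinM muleA.
rewrite ge0_integral_fsum//; last 2 first.
- by move=> r; exact: measurable_funeM.
- by move=> r x _; rewrite muleA mule_ge0//; [exact: nnfun_muleindic_ge0|rewrite lee_fin].
apply: eq_fsbigr => r /[!inE] -[y _ <-].
rewrite ge0_integralZl//; last 2 first.
- by move=> x _; rewrite mule_ge0 ?lee_fin.
- by rewrite lee_fin.
by rewrite integral_law_indic.
Qed.

End law.

(** * The law of the total Green mass *)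

Section green_mass.
Context {R : realType}.

(** The quantity through which an indistinguishable set acts on its complement:
    the outside weights W k i do not depend on i in the set, so only the sum of
    all entries of its Green matrix enters the Schur complement. *)
Definition green_mass n (W : 'M[R]_n) (u : 'cV[R]_n) : R :=
  dotcV (const_mx 1) (invmx (Hm W u) *m const_mx 1).

Lemma measurable_green_mass n (W : 'M[R]_n) : measurable_fun setT (green_mass W).
Proof.
apply: measurable_fun_dotcV => //; apply: measurable_fun_mulmx => //.
by apply: measurable_fun_invmx; exact: measurable_Hm.
Qed.

Lemma mass_gt0 n (A : 'M[R]_n) : (0 < n)%N -> posdefmx A ->
  0 < dotcV (const_mx 1) (invmx A *m const_mx 1).
Proof.
move=> n0 pA; have uA := posdefmx_unit pA; have [sA pos] := pA.
have x0 : invmx A *m const_mx 1 != 0 :> 'cV_n.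
  apply/eqP => /(congr1 (mulmx A)); rewrite mulKVmx// mulmx0.
  by move/matrixP/(_ (Ordinal n0) ord0)/eqP; rewrite !mxE oner_eq0.
have := pos _ x0; rewrite trmx_mul invmx_sym// -!mulmxA mulKVmx//.
by rewrite dotcVE.
Qed.

Lemma green_mass_gt0 n (W : 'M[R]_n) u : (0 < n)%N -> posdefmx (Hm W u) -> 0 < green_mass W u.
Proof. exact: mass_gt0. Qed.

Lemma const_mxZ n (a : R) : const_mx a = a *: const_mx 1 :> 'cV[R]_n.
Proof. by apply/matrixP => i j; rewrite !mxE mulr1. Qed.

(** A constant boundary condition k contributes k^2 green_mass / 2 to the exponent:
    changing it tilts the density by an exponential of the mass. With the
    partition function this computes the Laplace transform of the mass. *)
Lemma dens_tilt n (W : 'M[R]_n) (h k : R) u :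
  dens W (const_mx k) u = expR (n%:R * (k - h)) *
    (expR (- (2^-1 * (k ^+ 2 - h ^+ 2) * green_mass W u)) * dens W (const_mx h) u).
Proof.
have [pH|npH] := pselect (posdefmx (Hm W u)); last by rewrite !dens0// !mulr0.
have one1 : dotcV (const_mx 1 : 'cV[R]_n) (const_mx 1) = n%:R.
  rewrite /dotcV (eq_bigr (fun=> 1)); last by move=> i _; rewrite !mxE mulr1.
  by rewrite sumr_const card_ord.
have E a : dotcV (const_mx a) (invmx (Hm W u) *m const_mx a) = a ^+ 2 * green_mass W u.
  by rewrite const_mxZ -scalemxAr dotcVZr dotcVZl mulrA.
have F a : dotcV (const_mx 1 : 'cV[R]_n) (const_mx a) = n%:R * a.
  by rewrite const_mxZ dotcVZr one1 mulrC.
rewrite !densE// !E !F.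
set X := _ ^+ n; set Y := (Num.sqrt _)^-1; set Q := dotcV _ _.
have -> : - 2^-1 * (Q + k ^+ 2 * green_mass W u - 2 * (n%:R * k)) =
  n%:R * (k - h) + (- (2^-1 * (k ^+ 2 - h ^+ 2) * green_mass W u) +
   - 2^-1 * (Q + h ^+ 2 * green_mass W u - 2 * (n%:R * h))) by field.
by rewrite !expRD; ring.
Qed.

Local Notation D := (`]0, +oo[%classic : set (measurableTypeR R)).

Section law_of_mass.
Variables (n : nat) (W : 'M[R]_n).
Hypotheses (n0 : (0 < n)%N) (sW : W^T = W) (W0 : forall i j, 0 <= W i j).
Variables (c k : R).
Hypotheses (c0 : 0 < c) (k0 : 0 < k).

Let mdens : measurable_fun setT (dens W (const_mx k)).
Proof. exact: measurable_dens. Qed.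

Let mmass : measurable_fun setT
  ((fun u => c * green_mass W u) : 'cV[R]_n -> measurableTypeR R).
Proof. by apply: measurable_funM => //; exact: measurable_green_mass. Qed.

Definition mass_law : {measure set (measurableTypeR R) -> \bar R} :=
  law (lebesgue_cV n) mdens (@dens_ge0 _ _ W (const_mx k)) mmass.

Lemma mass_law_supp : mass_law (~` D) = 0%E.
Proof.
rewrite lawE; apply: integral0_eq => u /=.
rewrite in_itv/= andbT => su.
rewrite dens0// => /(green_mass_gt0 n0) s0.
by apply: su; rewrite mulr_gt0.
Qed.

(** The exponential of - l c green_mass turns the boundary condition k into the
    boundary condition sqrt (k^2 + 2 l c), whose density has total mass 1. *)
Lemma laplace_mass_law l : 0 <= l ->
  laplace mass_law l = (expR (- (n%:R * (Num.sqrt (k ^+ 2 + 2 * l * c) - k))))%:E.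
Proof.
move=> l0; set k' := Num.sqrt _.
have k'2 : k' ^+ 2 = k ^+ 2 + 2 * l * c.
  by rewrite sqr_sqrtr// addr_ge0 ?sqr_ge0// mulr_ge0 ?(ltW c0)// mulr_ge0.
have k'0 : 0 < k'.
  by rewrite sqrtr_gt0 ltr_pwDl ?exprn_gt0// mulr_ge0 ?(ltW c0)// mulr_ge0.
rewrite /laplace integral_mkcond ge0_integral_law; last 2 first.
- apply/(measurable_restrictT _ _).1; first exact: measurable_itv.
  apply/measurable_EFinP; apply: measurable_funTS.
  apply: (measurableT_comp (@measurable_expR R)).
  by apply: measurable_funN; apply: measurable_funM.
- by move=> x; rewrite patchE; case: ifP => // _; rewrite lee_fin expR_ge0.
transitivity (\int[lebesgue_cV n]_u ((expR (- (n%:R * (k' - k))))%:E *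
   (dens W (const_mx k') u)%:E))%E.
  apply: eq_integral => u _.
  have [pH|npH] := pselect (posdefmx (Hm W u)); last by rewrite !dens0// !mule0.
  rewrite patchE ifT; last first.
    by rewrite inE/= in_itv/= andbT mulr_gt0// green_mass_gt0.
  rewrite -!EFinM (dens_tilt W k k') k'2; move: (dens W (const_mx k) u) => d'.
  by rewrite !mulrA -expRD addNr expR0 mul1r; congr (expR _ * _)%:E; field.
rewrite ge0_integralZl//.
- by rewrite integral_dens ?mule1// => i; rewrite mxE.
- by apply/measurable_EFinP; exact: measurable_dens.
- by move=> u _; rewrite lee_fin dens_ge0.
Qed.

Lemma mass_law_finite : (mass_law D < +oo)%E.
Proof. by rewrite -laplace0 laplace_mass_law// ltry. Qed.

Lemma integral_mass_law (g : measurableTypeR R -> \bar R) : measurable_fun setT g ->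
  (forall x, 0 <= g x)%E ->
  (\int[mass_law]_x g x =
   \int[lebesgue_cV n]_u (g (c * green_mass W u)%R * (dens W (const_mx k) u)%:E))%E.
Proof. by move=> mg g0; rewrite ge0_integral_law. Qed.

End law_of_mass.

(** The mass of n vertices with boundary condition h has the law of n^2 times the
    mass of a single vertex with boundary condition n h: both Laplace transforms
    depend on n and h in the same way. The weights inside the set are forgotten. *)
Lemma mass_reduction n (W : 'M[R]_n) (h : R) (Phi : measurableTypeR R -> \bar R) :
  (0 < n)%N -> W^T = W -> (forall i j, 0 <= W i j) -> 0 <= h ->
  measurable_fun setT Phi -> (forall x, 0 <= Phi x)%E ->
  (\int[lebesgue_cV n]_u (Phi (green_mass W u) * (dens W (const_mx h) u)%:E) =
   \int[lebesgue_cV 1]_b (Phi (n%:R ^+ 2 * green_mass (0 : 'M[R]_1) b)%R *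
      (dens (0 : 'M[R]_1) (const_mx (n%:R * h)%R) b)%:E))%E.
Proof.
(* The law of the mass is known for positive boundary conditions only; the tilt
   from h to h + 1 covers h = 0. *)
move=> n0 sW W0 h0 mPhi Phi0; pose k := h + 1.
have k0 : 0 < k by rewrite ltr_wpDl.
have nR : 0 < n%:R :> R by rewrite ltr0n.
have n20 : 0 < n%:R ^+ 2 :> R by rewrite exprn_gt0.
have nk0 : 0 < n%:R * k by rewrite mulr_gt0.
have s0 : (0 : 'M[R]_1)^T = 0 by rewrite trmx0.
have p0 i j : 0 <= (0 : 'M[R]_1) i j by rewrite mxE.
pose g (x : measurableTypeR R) : \bar R := (Phi x *
  (expR (n%:R * (h - k)) * expR (- (2^-1 * (h ^+ 2 - k ^+ 2) * x)))%R%:E)%E.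
have mg : measurable_fun setT g.
  apply: emeasurable_funM => //; apply/measurable_EFinP; apply: measurable_funM => //.
  apply: (measurableT_comp (@measurable_expR R)).
  by apply: measurable_funN; apply: measurable_funM.
have g0 x : (0 <= g x)%E by rewrite mule_ge0// lee_fin mulr_ge0 ?expR_ge0.
transitivity (\int[mass_law W 1 k]_x g x)%E.
  rewrite (integral_mass_law W 1 k mg g0); apply: eq_integral => u _.
  rewrite mul1r /g -muleA -EFinM (dens_tilt W k h).
  by move: (dens W (const_mx k) u) => d'; rewrite mulrA.
rewrite (eq_measure_integral (mass_law (0 : 'M[R]_1) (n%:R ^+ 2) (n%:R * k))).
  rewrite (integral_mass_law _ _ _ mg g0); apply: eq_integral => u _.
  rewrite /g -muleA -EFinM (dens_tilt 0 (n%:R * k) (n%:R * h)).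
  move: (dens 0 (const_mx (n%:R * k)) u) => d'; rewrite mulrA.
  by congr (_ * (expR _ * expR _ * _)%:E)%E; ring.
move=> A mA _; apply: laplace_unique => //.
- exact: mass_law_finite.
- exact: mass_law_supp.
- exact: mass_law_supp.
- move=> l l0; rewrite !laplace_mass_law//; congr (expR _)%:E.
  have -> : (n%:R * k) ^+ 2 + 2 * l * n%:R ^+ 2 = n%:R ^+ 2 * (k ^+ 2 + 2 * l * 1).
    by ring.
  by rewrite sqrtrM ?sqr_ge0// sqrtr_sqr ger0_norm ?(ltW nR)//; ring.
Qed.

End green_mass.

(** * Relabelling vertices and rank-one couplings *)

Lemma det_mxsub_inj (R : realType) n N (s : 'I_N -> 'I_n) (A : 'M[R]_n) :
  N = n -> injective s -> \det (mxsub s s A) = \det A.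
Proof.
move=> nN; case: n / nN s A => s A s_inj; pose q : 'S_N := perm s_inj.
have -> : mxsub s s A = row_perm q (col_perm q A).
  by apply/matrixP => i j; rewrite !mxE !permE.
rewrite row_permE col_permE !det_mulmx !det_perm odd_permV mulrCA -signr_addb addbb.
by rewrite mulr1.
Qed.

Section reindex.
Context {R : realType} (n N : nat) (s : 'I_N -> 'I_n) (r : 'I_n -> 'I_N).
Hypotheses (rK : cancel r s) (sK : cancel s r).

Let bs : bijective s. Proof. by exists r. Qed.

Lemma mxsub_mulmx (A B : 'M[R]_n) : mxsub s s (A *m B) = mxsub s s A *m mxsub s s B.
Proof.
apply/matrixP => i j; rewrite !mxE (reindex s)/=; last by exists r => k _; rewrite ?rK ?sK.
by apply: eq_bigr => k _; rewrite !mxE.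
Qed.

Lemma rowsub_mulmx p (A : 'M[R]_n) (x : 'M[R]_(n, p)) :
  rowsub s (A *m x) = mxsub s s A *m rowsub s x.
Proof.
apply/matrixP => i j; rewrite !mxE (reindex s)/=; last by exists r => k _; rewrite ?rK ?sK.
by apply: eq_bigr => k _; rewrite !mxE.
Qed.

Lemma mxsub_inj : injective (mxsub s s : 'M[R]_n -> 'M[R]_N).
Proof.
move=> A B /matrixP AB; apply/matrixP => i j.
by have := AB (r i) (r j); rewrite !mxE !rK.
Qed.

Lemma mxsub1 : mxsub s s (1%:M : 'M[R]_n) = 1%:M.
Proof. by apply/matrixP => i j; rewrite !mxE (inj_eq (can_inj sK)). Qed.

Lemma det_mxsub (A : 'M[R]_n) : \det (mxsub s s A) = \det A.
Proof.
apply: det_mxsub_inj; last exact: can_inj sK.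
by have := bij_eq_card bs; rewrite !card_ord.
Qed.

Lemma unitmx_mxsub (A : 'M[R]_n) : (mxsub s s A \in unitmx) = (A \in unitmx).
Proof. by rewrite !unitmxE det_mxsub. Qed.

Lemma invmx_mxsub (A : 'M[R]_n) : invmx (mxsub s s A) = mxsub s s (invmx A).
Proof.
have [uA|nA] := boolP (A \in unitmx); last first.
  by rewrite /invmx unitmx_mxsub (negbTE nA).
by apply: invmx_uniq; rewrite -mxsub_mulmx mulmxV// mxsub1.
Qed.

Lemma dotcV_rowsub (x y : 'cV[R]_n) : dotcV (rowsub s x) (rowsub s y) = dotcV x y.
Proof.
rewrite /dotcV [RHS](reindex s)/=; last by exists r => k _; rewrite ?rK ?sK.
by apply: eq_bigr => k _; rewrite !mxE.
Qed.

Lemma posdefmx_mxsub (A : 'M[R]_n) : posdefmx (mxsub s s A) <-> posdefmx A.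
Proof.
have qE (x : 'cV[R]_n) : (x^T *m A *m x) ord0 ord0 =
    ((rowsub s x)^T *m mxsub s s A *m rowsub s x) ord0 ord0.
  by rewrite -!mulmxA -rowsub_mulmx -!dotcVE dotcV_rowsub.
split=> [[sA pA]|[sA pA]]; split.
- by apply: mxsub_inj; rewrite -[RHS]sA; apply/matrixP => i j; rewrite !mxE.
- move=> x x0; rewrite qE; apply: pA; apply: contra x0 => /eqP/matrixP x0.
  by apply/eqP/matrixP => i j; have := x0 (r i) j; rewrite !mxE rK.
- by rewrite -[in RHS]sA; apply/matrixP => i j; rewrite !mxE.
- move=> x x0; pose y := \col_i x (r i) ord0.
  have xE : x = rowsub s y by apply/matrixP => i j; rewrite !mxE sK ord1.
  rewrite xE -qE; apply: pA; apply: contra x0 => /eqP y0.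
  by rewrite xE y0; apply/eqP/matrixP => i j; rewrite !mxE.
Qed.

Lemma Hm_reindex (W : 'M[R]_n) (x : 'cV[R]_N) :
  mxsub s s (Hm W (rowsub r x)) = Hm (mxsub s s W) x.
Proof. by apply/matrixP => i j; rewrite !mxE (inj_eq (can_inj sK)) sK. Qed.

Lemma dens_reindex (W : 'M[R]_n) (eta : 'cV[R]_n) (x : 'cV[R]_N) :
  dens W eta (rowsub r x) = dens (mxsub s s W) (rowsub s eta) x.
Proof.
have eN : Num.sqrt (2 / pi) ^+ N = Num.sqrt (2 / pi) ^+ n :> R.
  by have := bij_eq_card bs; rewrite !card_ord => ->.
have [pH|npH] := pselect (posdefmx (Hm W (rowsub r x))); last first.
  by rewrite !dens0// -Hm_reindex posdefmx_mxsub.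
rewrite !densE// -?Hm_reindex ?posdefmx_mxsub// det_mxsub invmx_mxsub eN.
have c1 : const_mx 1 = rowsub s (const_mx 1) :> 'cV[R]_N.
  by apply/matrixP => i j; rewrite !mxE.
by rewrite c1 -!rowsub_mulmx !dotcV_rowsub.
Qed.

End reindex.

Section rank_one.
Context {R : realType} (m p : nat) (A : 'M[R]_m) (w0 : 'rV[R]_p) (D : 'M[R]_p).
Hypothesis sA : A^T = A.

(** The conditional density of the outside coordinates v given the mass x of the
    inside Green matrix. *)
Definition outer_dens (e : R) (ed : 'cV[R]_p) (x : R) (v : 'cV[R]_p) : R :=
  dens (D + x *: (w0^T *m w0)) (ed + (e * x) *: w0^T)
       (v - \col_i (2^-1 * (x * w0 ord0 i ^+ 2))).

(** The conditioning lemma for the rank-one weights 1 (c w0) and the constant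
    boundary condition c e. The original graph is the case c = 1, the reduced graph
    the case m = 1 in which c is the number of merged vertices. *)
Lemma dens_block_rank1 (c e : R) (ed : 'cV[R]_p) (u : 'cV[R]_m) (v : 'cV[R]_p) :
  let w : 'M[R]_(m, p) := const_mx 1 *m (c *: w0) in
  dens (block_mx A w w^T D) (col_mx (const_mx (c * e)) ed) (col_mx u v) =
  dens A (const_mx (c * (e + \sum_i w0 ord0 i))) u *
  outer_dens e ed (c ^+ 2 * green_mass A u) v.
Proof.
move=> w; rewrite dens_block//.
have wT : w^T = (c *: w0^T) *m (const_mx 1 : 'rV_m).
  by rewrite /w trmx_mul linearZ/= trmx_const.
have wGw : w^T *m invmx (Hm A u) *m w = (c ^+ 2 * green_mass A u) *: (w0^T *m w0).
  rewrite wT /w !mulmxA -2![c *: w0^T *m _ *m _]mulmxA -[_ *m _ *m const_mx 1]mulmxA.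
  rewrite [const_mx 1 *m (_ *m _)](_ : _ = (green_mass A u)%:M); last first.
    apply/matrixP => i j; rewrite !ord1 [RHS]mxE eqxx /green_mass dotcVE trmx_const.
    by rewrite mulmxA.
  by rewrite mul_mx_scalar -scalemxAr -!scalemxAl !scalerA; congr (_ *: _); ring.
have wGe : w^T *m invmx (Hm A u) *m const_mx (c * e) = (e * (c ^+ 2 * green_mass A u)) *: w0^T.
  rewrite const_mxZ -scalemxAr wT -!mulmxA.
  rewrite [const_mx 1 *m (_ *m _)](_ : _ = (green_mass A u)%:M); last first.
    apply/matrixP => i j; rewrite !ord1 [RHS]mxE eqxx /green_mass dotcVE trmx_const.
    by rewrite mulmxA.
  by rewrite mul_mx_scalar !scalerA; congr (_ *: _); ring.
congr (dens _ _ _ * _).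
  apply/matrixP => i j; rewrite !mxE mulrDr mulr_sumr; congr (_ + _).
  by apply: eq_bigr => k _; rewrite !mxE big_ord1 !mxE mul1r mulr1.
rewrite wGw wGe /outer_dens; congr (dens _ _ (_ - _)).
apply/matrixP => i j; rewrite !mxE big_ord1 !mxE; ring.
Qed.

Lemma measurable_outer_dens d (T : measurableType d) e ed (x : T -> R) (v : T -> 'cV[R]_p) :
  measurable_fun setT x -> measurable_fun setT v ->
  measurable_fun setT (fun z => outer_dens e ed (x z) (v z)).
Proof.
move=> mx mv; have mscale k l (y : T -> R) (M : 'M[R]_(k, l)) : measurable_fun setT y ->
    measurable_fun setT (fun z => y z *: M).
  move=> my; apply/measurable_fun_mxP => i j; under eq_fun do rewrite mxE.
  exact: measurable_funM.
apply: measurable_dens.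
- by apply: measurable_fun_addmx => //; exact: mscale.
- by apply: measurable_fun_addmx => //; apply: mscale; exact: measurable_funM.
- apply: measurable_fun_addmx => //; apply: measurable_fun_oppmx.
  apply/measurable_fun_mxP => i j; under eq_fun do rewrite mxE.
  by apply: measurable_funM => //; exact: measurable_funM.
Qed.

End rank_one.

(** * The averaged Green matrix *)

Section averaged_inverse.
Context {R : realType} (m p : nat).

Definition avg : 'M[R]_(1 + p, m + p) :=
  block_mx (m%:R^-1 *: const_mx 1) 0 0 1%:M.

(** H and H' have the same Schur complement D - s w0^T w0: in H' the weights m w0
    are divided by the pivot m^2 / s. The block formulas for the two inverses then
    agree after averaging. *)
Lemma averaged_green (A : 'M[R]_m) (w0 : 'rV[R]_p) (D : 'M[R]_p) :
  (0 < m)%N ->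
  let w : 'M[R]_(m, p) := const_mx 1 *m w0 in
  let s := dotcV (const_mx 1) (invmx A *m const_mx 1) in
  let H := block_mx A (- w) (- w)^T D in
  let H' := block_mx ((m%:R ^+ 2 / s)%:M : 'M[R]_1) (- (m%:R *: w0))
                     (- (m%:R *: w0))^T D in
  posdefmx H -> posdefmx H' /\ invmx H' = avg *m invmx H *m avg^T.
Proof.
move=> m0 w s H H' /posdefmx_block[pA pS].
have mR : m%:R != 0 :> R by rewrite pnatr_eq0 -lt0n.
have s0 : 0 < s by exact: mass_gt0.
have sn0 := lt0r_neq0 s0.
pose a := m%:R ^+ 2 / s.
have a0 : 0 < a by rewrite divr_gt0// exprn_gt0// lt_neqAle eq_sym mR ler0n.
have [sA _] := pA; have uA := posdefmx_unit pA; have uS := posdefmx_unit pS.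
pose o : 'cV[R]_m := const_mx 1.
have TN k l (M : 'M[R]_(k, l)) : (- M)^T = - M^T by exact: linearN.
have TZ k l c (M : 'M[R]_(k, l)) : (c *: M)^T = c *: M^T by exact: linearZ.
have oGo : o^T *m invmx A *m o = s%:M.
  by apply/matrixP => i j; rewrite !ord1 [RHS]mxE eqxx /s dotcVE mulmxA.
have SE : schur_compl (a%:M : 'M[R]_1) (- (m%:R *: w0)) D = schur_compl A (- w) D.
  rewrite /schur_compl /w; congr (_ - _).
  rewrite invmx_scalar1 !TN !mulNmx !mulmxN !opprK !TZ trmx_mul -/o.
  rewrite !mulmxA -[_ *m o^T *m invmx A]mulmxA -[_ *m (o^T *m _) *m o]mulmxA oGo.
  rewrite !mul_mx_scalar -?scalemxAl -?scalemxAr -?scalemxAl !scalerA; congr (_ *: _).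
  by rewrite /a; field; rewrite mR sn0.
have pa : posdefmx (a%:M : 'M[R]_1) by rewrite posdefmx_scalar.
have pH' : posdefmx H' by apply/posdefmx_block; split=> //; rewrite SE.
split=> //; rewrite /H' /H invmx_schur ?SE//; last 2 first.
- by rewrite tr_scalar_mx.
- exact: posdefmx_unit.
rewrite invmx_schur// /avg tr_block_mx !trmx0 trmx1.
rewrite !mulmx_block !(mul0mx, mulmx0, mul1mx, mulmx1, addr0, add0r).
set Si := invmx (schur_compl _ _ _); rewrite invmx_scalar1.
have ai : a^-1 = s / m%:R ^+ 2 by rewrite /a invf_div.
rewrite !TN !mulmxN !mulNmx !mulmxN !opprK !TZ trmx_mul -/o.
set iA := invmx A in oGo *.
have oT : (const_mx 1 : 'rV[R]_m) = o^T by rewrite trmx_const.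
rewrite oT trmxK /w.
rewrite -/a ai -/o; congr block_mx.
- rewrite mulmxDr mulmxDl -!scalemxAl -!scalemxAr !scalerA !mulmxA oGo.
  rewrite -[_ *m o^T *m iA]mulmxA -[_ *m (o^T *m iA) *m o]mulmxA oGo.
  rewrite !mul_mx_scalar !mul_scalar_mx -!scalemxAl -?scalemxAr -?scalemxAl !scalerA.
  congr (_ + _ *: _); last by field.
  by rewrite scale_scalar_mx; congr (_%:M); field.
- rewrite -!scalemxAl !mulmxA oGo !mul_scalar_mx -!scalemxAl !scalerA.
  by congr (_ *: _); field.
- rewrite -!scalemxAr !mulmxA -[_ *m o^T *m iA]mulmxA -[_ *m (o^T *m iA) *m o]mulmxA.
  rewrite oGo !mul_mx_scalar -?scalemxAl !scalerA.
  by congr (_ *: _); field.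
Qed.

End averaged_inverse.

(** * Reduction of the graph *)

Section reduction.
Context {R : realType} (V : finType) (U : {set V}).
Local Notation T := {k : V | k \notin U}.
Local Notation m := #|U|.
Local Notation p := #|{: T}|.

(** The vertices of U first, then the others; red_idx puts the merged vertex
    first. *)
Definition split_idx (i : 'I_(m + p)) : 'I_#|V| :=
  match fintype.split i with
  | inl k => enum_rank (enum_val k)
  | inr l => enum_rank (val (enum_val l))
  end.

Definition red_idx (i : 'I_(1 + p)) : 'I_#|redV U| :=
  match fintype.split i with
  | inl _ => enum_rank (None : redV U)
  | inr l => enum_rank (Some (enum_val l) : redV U)
  end.

Lemma split_idxL k : split_idx (lshift p k) = enum_rank (enum_val k).
Proof. by rewrite /split_idx (unsplitK (inl k)). Qed.

Lemma split_idxR l : split_idx (rshift m l) = enum_rank (val (enum_val l)).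
Proof. by rewrite /split_idx (unsplitK (inr l)). Qed.

Lemma red_idxL k : red_idx (lshift p k) = enum_rank None.
Proof. by rewrite /red_idx (unsplitK (inl k)). Qed.

Lemma red_idxR l : red_idx (rshift 1 l) = enum_rank (Some (enum_val l)).
Proof. by rewrite /red_idx (unsplitK (inr l)). Qed.

Lemma split_idx_bij : bijective split_idx.
Proof.
apply: inj_card_bij.
  move=> i j; case: (split_ordP i) => k ->; case: (split_ordP j) => l ->;
    rewrite ?split_idxL ?split_idxR => /enum_rank_inj.
  - by move/enum_val_inj => ->.
  - by move=> kl; have := enum_valP k; rewrite kl (negbTE (valP (enum_val l))).
  - by move=> kl; have := enum_valP l; rewrite -kl (negbTE (valP (enum_val k))).
  - by move/val_inj/enum_val_inj => ->.
have -> : p = #|~: U|%SET by rewrite card_sig; apply: eq_card => x; rewrite !inE.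
by rewrite !card_ord cardsC.
Qed.

Lemma red_idx_bij : bijective red_idx.
Proof.
apply: inj_card_bij; last by rewrite !card_ord card_option.
move=> i j; case: (split_ordP i) => k ->; case: (split_ordP j) => l ->;
  rewrite ?red_idxL ?red_idxR => /enum_rank_inj //.
- by rewrite !ord1.
- by case=> /enum_val_inj ->.
Qed.

Section graph.
Variables (W : V -> V -> R) (eta : V -> R) (u0 : V).
Hypotheses (sW : forall i j, W i j = W j i) (u0U : u0 \in U).
Hypothesis indist : indistinguishable W eta U.

Definition blockU : 'M[R]_m := \matrix_(i, j) W (enum_val i) (enum_val j).
Definition blockC : 'M[R]_p := \matrix_(k, l) W (val (enum_val k)) (val (enum_val l)).
(** The common weight between an outside vertex and the vertices of U; u0 is any
    vertex of U. *)
Definition outw : 'rV[R]_p := \row_l W (val (enum_val l)) u0.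
Definition outeta : 'cV[R]_p := \col_l eta (val (enum_val l)).

Definition Wmx (X : finType) (w : X -> X -> R) : 'M[R]_#|X| :=
  \matrix_(i, j) w (enum_val i) (enum_val j).
Definition etamx (X : finType) (h : X -> R) : 'cV[R]_#|X| :=
  \col_i h (enum_val i).

Lemma HmxE (X : finType) (w : X -> X -> R) b : Hmx w b = Hm (Wmx w) b.
Proof. by apply/matrixP => i j; rewrite !mxE. Qed.

Let WoutE (x : T) i : i \in U -> W (val x) i = W (val x) u0.
Proof. by move=> iU; exact: (indist.1 _ _ _ iU u0U (valP x)). Qed.

Lemma Wmx_split : mxsub split_idx split_idx (Wmx W) =
  let w : 'M[R]_(m, p) := const_mx 1 *m (1 *: outw) in
  block_mx blockU w w^T blockC.
Proof.
apply/matrixP => i j; rewrite [LHS]mxE [LHS]mxE.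
case: (split_ordP i) => k ->; case: (split_ordP j) => l ->;
  rewrite ?(split_idxL, split_idxR, enum_rankK);
  rewrite ?(block_mxEul, block_mxEur, block_mxEdl, block_mxEdr) !mxE ?big_ord1 ?mxE ?mul1r //.
- by rewrite sW WoutE// enum_valP.
- by rewrite WoutE// enum_valP.
Qed.

Lemma Wmx_red : mxsub red_idx red_idx (Wmx (redW U W)) =
  let w : 'M[R]_(1, p) := const_mx 1 *m (m%:R *: outw) in
  block_mx 0 w w^T blockC.
Proof.
have sumW (x : T) : \sum_(i in U) W (val x) i = m%:R * W (val x) u0.
  rewrite (eq_bigr (fun=> W (val x) u0)); last by move=> i iU; rewrite WoutE.
  by rewrite sumr_const mulr_natl.
apply/matrixP => i j; rewrite [LHS]mxE [LHS]mxE.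
case: (split_ordP i) => k ->; case: (split_ordP j) => l ->;
  rewrite ?(red_idxL, red_idxR, enum_rankK);
  rewrite ?(block_mxEul, block_mxEur, block_mxEdl, block_mxEdr) !mxE ?big_ord1 ?mxE ?mul1r
    //= ?sumW //.
Qed.

Lemma etamx_split : rowsub split_idx (etamx eta) = col_mx (const_mx (1 * eta u0)) outeta.
Proof.
apply/matrixP => i j; rewrite [LHS]mxE [LHS]mxE.
case: (split_ordP i) => k ->; rewrite ?(split_idxL, split_idxR, enum_rankK);
  rewrite ?(col_mxEu, col_mxEd) !mxE// mul1r.
exact: (indist.2 _ _ (enum_valP k) u0U).
Qed.

Lemma etamx_red : rowsub red_idx (etamx (redeta U eta)) =
  col_mx (const_mx (m%:R * eta u0)) outeta.
Proof.
apply/matrixP => i j; rewrite [LHS]mxE [LHS]mxE.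
case: (split_ordP i) => k ->; rewrite ?(red_idxL, red_idxR, enum_rankK);
  rewrite ?(col_mxEu, col_mxEd) !mxE//=.
rewrite (eq_bigr (fun=> eta u0)); last by move=> i' iU; exact: (indist.2 _ _ iU u0U).
by rewrite sumr_const mulr_natl.
Qed.

Variables (rV : 'I_#|V| -> 'I_(m + p)) (rR : 'I_#|redV U| -> 'I_(1 + p)).
Hypotheses (rVK : cancel rV split_idx) (sVK : cancel split_idx rV).
Hypotheses (rRK : cancel rR red_idx) (sRK : cancel red_idx rR).

Lemma Hmx_split u v : mxsub split_idx split_idx (Hmx W (glue rV (u, v))) =
  let w : 'M[R]_(m, p) := const_mx 1 *m (1 *: outw) in
  block_mx (Hm blockU u) (- w) (- w)^T (Hm blockC v).
Proof. by rewrite HmxE /glue Hm_reindex// Wmx_split Hm_block. Qed.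

Lemma Hmx_red u v : mxsub red_idx red_idx (Hmx (redW U W) (glue rR (u, v))) =
  let w : 'M[R]_(1, p) := const_mx 1 *m (m%:R *: outw) in
  block_mx (Hm 0 u) (- w) (- w)^T (Hm blockC v).
Proof. by rewrite HmxE /glue Hm_reindex// Wmx_red Hm_block. Qed.

Lemma submxU_glue u v : submxU U (Hmx W (glue rV (u, v))) = Hm blockU u.
Proof.
apply/matrixP => i j; rewrite mxE -!split_idxL.
have := Hmx_split u v => /matrixP/(_ (lshift p i) (lshift p j)).
by rewrite mxE => ->; rewrite block_mxEul.
Qed.

Lemma green_mass_sum n (A : 'M[R]_n) u :
  green_mass A u = \sum_i \sum_j invmx (Hm A u) i j.
Proof.
rewrite /green_mass /dotcV; apply: eq_bigr => i _; rewrite !mxE mul1r.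
by apply: eq_bigr => j _; rewrite mxE mulr1.
Qed.

(** The value of beta' at the merged vertex, as a function of the mass. *)
Definition mass_beta (s : R) : R := (2 * ((m%:R ^+ 2)^-1 * s))^-1.

Lemma redbeta_glue u v : redbeta U W (glue rV (u, v)) =
  glue rR (const_mx (mass_beta (green_mass blockU u)), v).
Proof.
have sub i : redbeta U W (glue rV (u, v)) (red_idx i) ord0 =
    col_mx (const_mx (mass_beta (green_mass blockU u))) v i ord0.
  rewrite mxE; case: (split_ordP i) => k ->; rewrite ?(red_idxL, red_idxR) enum_rankK.
    by rewrite submxU_glue -green_mass_sum col_mxEu mxE.
  by rewrite col_mxEd -split_idxR mxE sVK col_mxEd.
apply/matrixP => i j; rewrite [j]ord1 -(rRK i) sub.
by rewrite [RHS]mxE sRK.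
Qed.

Lemma redG_avg (G : 'M[R]_#|V|) : G^T = G ->
  mxsub red_idx red_idx (redG U G) =
  avg m p *m mxsub split_idx split_idx G *m (avg m p)^T.
Proof.
move=> sG.
pose g (i j : V) := G (enum_rank i) (enum_rank j).
have gC i j : g i j = g j i by rewrite /g -{1}sG mxE.
have -> : mxsub split_idx split_idx G =
  block_mx (\matrix_(i, j) g (enum_val i) (enum_val j))
    (\matrix_(i, l) g (enum_val i) (val (enum_val l)))
    (\matrix_(k, j) g (val (enum_val k)) (enum_val j))
    (\matrix_(k, l) g (val (enum_val k)) (val (enum_val l))).
  apply/matrixP => i j; rewrite mxE.
  by case: (split_ordP i) => k ->; case: (split_ordP j) => l ->;
    rewrite ?(split_idxL, split_idxR);
    rewrite ?(block_mxEul, block_mxEur, block_mxEdl, block_mxEdr) !mxE.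
rewrite /avg tr_block_mx !trmx0 trmx1 !mulmx_block.
rewrite !(mul0mx, mulmx0, mul1mx, mulmx1, addr0, add0r).
have sumU (f : V -> R) : \sum_(i in U) f i = \sum_(k < m) f (enum_val k).
  by rewrite -big_enum_val.
apply/matrixP => i j; rewrite [LHS]mxE [LHS]mxE.
case: (split_ordP i) => k ->; case: (split_ordP j) => l ->;
  rewrite ?(red_idxL, red_idxR, enum_rankK);
  rewrite ?(block_mxEul, block_mxEur, block_mxEdl, block_mxEdr) !mxE //.
- transitivity (\sum_(j0 < m) \sum_(i0 < m) m%:R ^- 2 * g (enum_val i0) (enum_val j0)).
    rewrite (sumU (fun i0 => \sum_(j0 in U) g i0 j0)) mulr_sumr [RHS]exchange_big.
    apply: eq_bigr => i0 _; rewrite (sumU (g (enum_val i0))) mulr_sumr.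
    by apply: eq_bigr.
  apply: eq_bigr => j0 _; rewrite !mxE mulr_suml; apply: eq_bigr => i0 _.
  by rewrite !mxE !mulr1 expr2 invfM; ring.
- rewrite (sumU (g (val (enum_val l)))) mulr_sumr; apply: eq_bigr => j0 _.
  by rewrite !mxE mulr1 gC.
- rewrite (sumU (g (val (enum_val k)))) mulr_sumr; apply: eq_bigr => j0 _.
  by rewrite !mxE mulr1 mulrC.
Qed.

Lemma redG_green b : posdefmx (Hmx W b) ->
  posdefmx (Hmx (redW U W) (redbeta U W b)) /\
  redG U (green W b) = green (redW U W) (redbeta U W b).
Proof.
have m0 : (0 < m)%N by apply/card_gt0P; exists u0.
have -> : b = glue rV (usubmx (rowsub split_idx b), dsubmx (rowsub split_idx b)).
  by rewrite /glue vsubmxK; apply/matrixP => i j; rewrite !mxE rVK.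
move: (usubmx _) (dsubmx _) => u v pH; rewrite redbeta_glue.
set M := Hmx W _ in pH *.
have pM : posdefmx (mxsub split_idx split_idx M) by apply/(posdefmx_mxsub rVK sVK).
have {}pM' := pM; rewrite Hmx_split /= in pM'.
have [pA _] := (posdefmx_block _ _ _).1 pM'.
rewrite scale1r in pM'.
have [pH' EH'] := averaged_green m0 pM'.
have ME : mxsub red_idx red_idx (Hmx (redW U W)
    (glue rR (const_mx (mass_beta (green_mass blockU u)), v))) =
  block_mx ((m%:R ^+ 2 / green_mass blockU u)%:M : 'M[R]_1) (- (m%:R *: outw))
           (- (m%:R *: outw))^T (Hm blockC v).
  rewrite Hmx_red /= Hm1 (_ : const_mx 1 = 1%:M :> 'M[R]_1) ?mul1mx; last exact: const_mx1.
  congr (block_mx _%:M); rewrite /mass_beta.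
  have g0 := green_mass_gt0 m0 pA; rewrite -/(green_mass _ _) in g0.
  by field; rewrite gt_eqF//= pnatr_eq0 -lt0n.
split.
  by apply/(posdefmx_mxsub rRK sRK); rewrite ME.
apply: (mxsub_inj rRK).
rewrite redG_avg; last by rewrite /green invmx_sym//; case: pH.
rewrite /green -(invmx_mxsub rVK sVK) -(invmx_mxsub rRK sRK) ME.
by rewrite Hmx_split /= scale1r EH'.
Qed.

Local Notation e := (eta u0).
Local Notation h := (e + \sum_l outw ord0 l).

Lemma dens_split u v : dens (Wmx W) (etamx eta) (glue rV (u, v)) =
  dens blockU (const_mx h) u *
  outer_dens outw blockC e outeta (green_mass blockU u) v.
Proof.
have sA : blockU^T = blockU by apply/matrixP => i j; rewrite !mxE sW.
rewrite /glue (dens_reindex rVK sVK) Wmx_split etamx_split /= dens_block_rank1//.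
by rewrite mul1r expr1n mul1r.
Qed.

Lemma dens_red u v :
  dens (Wmx (redW U W)) (etamx (redeta U eta)) (glue rR (u, v)) =
  dens 0 (const_mx (m%:R * h)) u *
  outer_dens outw blockC e outeta (m%:R ^+ 2 * green_mass 0 u) v.
Proof.
by rewrite /glue (dens_reindex rRK sRK) Wmx_red etamx_red /= dens_block_rank1// trmx0.
Qed.

Hypotheses (W0 : forall i j, 0 <= W i j) (eta0 : forall i, 0 <= eta i).

Lemma measurable_redbeta : measurable_fun setT (redbeta U W).
Proof.
apply/measurable_fun_mxP => k j; under eq_fun do rewrite mxE.
case: (enum_val k) => [x|]; first exact: measurable_entry.
apply: measurable_fun_inv; apply: measurable_funM => //; apply: measurable_funM => //.
apply: measurable_sum => i; apply: measurable_sum => l.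
have : measurable_fun setT (fun b => invmx (submxU U (Hmx W b))).
  apply: measurable_fun_invmx; apply/measurable_fun_mxP => i' j'.
  under eq_fun do rewrite mxE HmxE.
  have : measurable_fun setT (fun b : 'cV[R]_#|V| => Hm (Wmx W) b) by exact: measurable_Hm.
  by move/measurable_fun_mxP; apply.
by move/measurable_fun_mxP; apply.
Qed.

(** The integrand over the outside coordinates depends on the coordinates of U
    only through the mass z.1. *)
Let Psi (B : set 'cV[R]_#|redV U|) (z : measurableTypeR R * 'cV[R]_p) : R :=
  \1_B (glue rR (const_mx (mass_beta z.1), z.2)) * outer_dens outw blockC e outeta z.1 z.2.

Let measurable_Psi B : measurable B -> measurable_fun setT (Psi B).
Proof.
move=> mB; have mglue : measurable_fun setT (fun z : measurableTypeR R * 'cV[R]_p =>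
    glue rR (const_mx (mass_beta z.1), z.2)).
  apply: (measurableT_comp (measurable_glue rR)).
  apply: measurable_fun_pair => //; apply/measurable_fun_mxP => i j.
  apply: (eq_measurable_fun (fun z => mass_beta z.1)) => [z _|]; first by rewrite mxE.
  by apply: measurable_fun_inv; apply: measurable_funM => //; exact: measurable_funM.
apply: measurable_funM.
  by apply: (measurableT_comp _ mglue); exact: measurable_indic.
exact: measurable_outer_dens.
Qed.

Let Psi_ge0 B z : 0 <= Psi B z.
Proof. by rewrite /Psi mulr_ge0 ?dens_ge0. Qed.

(** The image of nu under redbeta is the reduced nu. Both sides integrate the same
    function of the mass and of the outside coordinates, first over the outside
    coordinates and then over the law of the mass, which mass_reduction says to be
    the same on both sides. *)
Lemma nu_redbeta (B : set 'cV[R]_#|redV U|) : measurable B ->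
  (\int[lebesgue_cV #|V|]_b
     (\1_B (redbeta U W b) * dens (Wmx W) (etamx eta) b)%:E =
   \int[lebesgue_cV #|redV U|]_b
     (\1_B b * dens (Wmx (redW U W)) (etamx (redeta U eta)) b)%:E)%E.
Proof.
move=> mB.
have m0 : (0 < m)%N by apply/card_gt0P; exists u0.
pose Phi (x : measurableTypeR R) : \bar R :=
  (\int[lebesgue_cV p]_v (Psi B (x, v))%:E)%E.
have mPhi : measurable_fun setT Phi.
  apply: (measurable_fun_fubini_tonelli_F (fun z => (Psi B z)%:E)).
    by apply/measurable_EFinP; exact: measurable_Psi.
  by move=> z; rewrite lee_fin.
have Phi0 x : (0 <= Phi x)%E by apply: integral_ge0 => v _; rewrite lee_fin.
have mPsi x : measurable_fun setT (fun v => (Psi B (x, v))%:E).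
  apply/measurable_EFinP; apply: (measurableT_comp (measurable_Psi mB)).
  exact: measurable_pair1.
have sA : blockU^T = blockU by apply/matrixP => i j; rewrite !mxE sW.
have A0 i j : 0 <= blockU i j by rewrite mxE.
have h0 : 0 <= h by rewrite addr_ge0// sumr_ge0// => l _; rewrite mxE.
rewrite (integral_cV_glue (r := rV)); last 3 first.
- by exists split_idx.
- apply: measurable_funM; last exact: measurable_dens.
  by apply: (measurableT_comp _ measurable_redbeta); exact: measurable_indic.
- by move=> b; rewrite mulr_ge0 ?dens_ge0.
rewrite (integral_cV_glue (r := rR)); last 3 first.
- by exists red_idx.
- by apply: measurable_funM; [exact: measurable_indic|exact: measurable_dens].
- by move=> b; rewrite mulr_ge0 ?dens_ge0.
transitivity (\int[lebesgue_cV m]_u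
    (Phi (green_mass blockU u) * (dens blockU (const_mx h) u)%:E))%E.
  apply: eq_integral => u _; rewrite /Phi -ge0_integralZr//.
  - apply: eq_integral => v _; rewrite redbeta_glue dens_split /Psi/=.
    by rewrite -EFinM; congr EFin; rewrite mulrCA mulrC.
  - by move=> v _; rewrite lee_fin.
  - by rewrite lee_fin dens_ge0.
rewrite mass_reduction//; apply: eq_integral => u _.
rewrite /Phi -ge0_integralZr//.
- apply: eq_integral => v _; rewrite dens_red /Psi/=.
  (* for a single vertex the mass is 1 / (2 b), and mass_beta inverts it *)
  have -> : const_mx (mass_beta (m%:R ^+ 2 * green_mass (0 : 'M[R]_1) u)) = u.
    apply/matrixP => i j; rewrite !ord1 mxE /mass_beta mulKf; last first.
      by rewrite expf_neq0// pnatr_eq0 -lt0n.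
    rewrite green_mass_sum !big_ord1 [u in LHS](_ : u = const_mx (u ord0 ord0)).
      rewrite Hm1 invmx_scalar1 mxE eqxx -[RHS]invrK; congr (_^-1).
      by rewrite invfM mulrA divff// mul1r.
    by apply/matrixP => i' j'; rewrite !ord1 mxE.
  by rewrite -EFinM; congr EFin; rewrite [RHS]mulrCA [LHS]mulrC.
- by move=> v _; rewrite lee_fin.
- by rewrite lee_fin dens_ge0.
Qed.

End graph.
End reduction.

(** * The theorem *)

Lemma measurable_sum_cond d (T : measurableType d) (R : realType) (I : finType)
    (Q : pred I) (h : I -> T -> R) : (forall i, measurable_fun setT (h i)) ->
  measurable_fun setT (fun x => \sum_(i | Q i) h i x).
Proof.
move=> mh; under eq_fun do rewrite big_mkcond.
by apply: measurable_sum => i; case: (Q i).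
Qed.

Section laws.
Context {R : realType}.

Lemma nuE (V : finType) (W : V -> V -> R) (eta : V -> R) (B : set 'cV[R]_#|V|) :
  nu W eta B =
  (\int[lebesgue_cV #|V|]_b (\1_B b * dens (Wmx W) (etamx eta) b)%:E)%E.
Proof.
rewrite /nu integral_mkcond; apply: eq_integral => b _.
rewrite patchE indicE nu_densityE -/(Wmx W) -/(etamx eta).
by case: (b \in B); rewrite ?mul1r ?mul0r.
Qed.

Lemma measurable_Hmx (V : finType) (W : V -> V -> R) :
  measurable_fun setT (Hmx W : 'cV[R]_#|V| -> _).
Proof.
rewrite (_ : Hmx W = Hm (Wmx W)); last by apply/funext => b; rewrite HmxE.
exact: measurable_Hm.
Qed.

Lemma measurable_green (V : finType) (W : V -> V -> R) :
  measurable_fun setT (green W : 'cV[R]_#|V| -> _).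
Proof. by apply: measurable_fun_invmx; exact: measurable_Hmx. Qed.

Lemma measurable_redG (V : finType) (U : {set V}) :
  measurable_fun setT (redG U : 'M[R]_#|V| -> _).
Proof.
apply/measurable_fun_mxP => k l; under eq_fun do rewrite mxE.
case: (enum_val k) => [x|]; case: (enum_val l) => [y|].
- exact: measurable_entry.
- by apply: measurable_funM => //; apply: measurable_sum_cond => i; exact: measurable_entry.
- by apply: measurable_funM => //; apply: measurable_sum_cond => i; exact: measurable_entry.
- apply: measurable_funM => //; apply: measurable_sum_cond => i.
  by apply: measurable_sum_cond => j; exact: measurable_entry.
Qed.

Lemma measurable_not_posdef (V : finType) (W : V -> V -> R) :
  measurable [set b : 'cV[R]_#|V| | ~ posdefmx (Hmx W b)].
Proof.
rewrite (_ : [set b | _] = ~` (Hmx W @^-1` [set H | posdefmx H])) //.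
apply: measurableC; rewrite -[X in measurable X]setTI.
by apply: measurable_Hmx => //; exact: measurable_posdefmx.
Qed.

Lemma nu_not_posdef (V : finType) (W : V -> V -> R) (eta : V -> R) :
  nu W eta [set b | ~ posdefmx (Hmx W b)] = 0%E.
Proof.
rewrite nuE; apply: integral0_eq => b _; rewrite indicE.
have [/set_mem npH|_] := boolP (b \in _); last by rewrite mul0r.
by rewrite dens0 ?mulr0// -HmxE.
Qed.

End laws.

Theorem theorem3 (R : realType) (V : finType) (W : V -> V -> R) (eta : V -> R)
    (U : {set V})
    (hW : weighted_graph W)
    (heta : forall i, 0 <= eta i)
    (hU0 : U != finset.set0)
    (hU : indistinguishable W eta U)
    (d : measure_display) (Omega : measurableType d) (P : probability Omega R)
    (beta : {RV P >-> 'cV[R]_#|V|})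
    (hbeta : forall A : set 'cV[R]_#|V|,
      measurable A -> distribution P beta A = nu W eta A) :
  (forall A : set 'M[R]_#|redV U|, measurable A ->
     pushforward P (fun w => redG U (green W (beta w))) A =
     pushforward (nu (redW U W) (redeta U eta)) (green (redW U W)) A) /\
  {ae P, forall w : Omega,
     redG U (green W (beta w)) \in unitmx /\
     invmx (redG U (green W (beta w))) =
       Hmx (redW U W) (redbeta U W (beta w))}.
Proof.
have [sW _ W0 _] := hW.
have /set0Pn[u0 u0U] := hU0.
have [rV sVK rVK] := split_idx_bij U.
have [rR sRK rRK] := red_idx_bij U.
have redE := redG_green sW u0U hU rVK sVK rRK sRK.
split=> [A mA|].
  have mB : measurable ((redG U \o green W) @^-1` A).
    rewrite -[X in measurable X]setTI; apply: measurableT_comp => //.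
      exact: measurable_redG.
    exact: measurable_green.
  have mB' : measurable (green (redW U W) @^-1` A).
    by rewrite -[X in measurable X]setTI; exact: measurable_green.
  transitivity (nu W eta ((redG U \o green W) @^-1` A)); first by rewrite -hbeta.
  rewrite /pushforward !nuE -(nu_redbeta sW u0U hU rVK sVK rRK sRK W0 heta mB').
  apply: eq_integral => b _.
  have [pH|npH] := pselect (posdefmx (Hmx W b)); last first.
    by rewrite dens0 ?mulr0// -HmxE.
  congr (_ * _)%:E; rewrite !indicE; congr (nat_of_bool _)%:R.
  by apply/idP/idP; rewrite !inE/= (redE b pH).2.
exists (beta @^-1` [set b | ~ posdefmx (Hmx W b)]); split.
- rewrite -[X in measurable X]setTI; apply: (measurable_funP beta) => //.
  exact: measurable_not_posdef.
- by rewrite -[LHS]/(distribution P beta _) hbeta ?nu_not_posdef//; exact: measurable_not_posdef.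
- move=> w /= nE /redE[pH' E]; apply: nE.
  have uH' := posdefmx_unit pH'.
  by rewrite E /green unitmx_inv invmxK.
Qed.
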